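(* Let $L>0$, let $K$ be a kernel satisfying the kernel conditions (K), let $h>0$ be the bandwidth, and let $q>0$, $M>0$. Let $\mu_1,\dots,\mu_n$ be i.i.d. random persistence measures on $\Omega$, distributed as $\mu$, with persistence intensity function $p$, such that almost surely $\max_{1\le i\le n}\int_\Omega\|\bm\omega-\partial\Omega\|_2^q\,\mathrm d\mu_i(\bm\omega)<M$, and such that $\bar p(\bm\omega):=\|\bm\omega-\partial\Omega\|_2^q\,p(\bm\omega)$ satisfies $\|\bar p\|_\infty<\infty$. Let $\rho_h$ be the persistence surface with weight function $f(\bm\omega)=\|\bm\omega-\partial\Omega\|_2^q$. Then there exists a constant $C$ depending on $L,M,L_K,\|K\|_\infty$ and $\|\bar p\|_\infty$ such that for any $\delta\in(0,1)$, with probability at least $1-\delta$, $$\|\rho_h(\bar\mu_n)-\rho_h(\mathbb E[\mu])\|_\infty\le C\max\left\{\frac1{nh^2}\log\frac1{\delta h^2},\;\sqrt{\frac1{nh^2}}\sqrt{\log\frac1{\delta h^2}}\right\}.$$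
   Context: $\Omega=\{(b,d):0<b<d\le L\}\subset\mathbb R^2$, $\partial\Omega=\{(x,x):0\le x\le L\}$, $\|\bm\omega-\partial\Omega\|_2=\min_{\bm x\in\partial\Omega}\|\bm\omega-\bm x\|_2$. For $g$ on $\Omega$, $\|g\|_\infty=\sup_\Omega|g|$. A persistence measure is the counting measure $\mu=\sum_i\delta_{\bm r_i}$ of a persistence diagram $\{\bm r_i\}$, a multiset of points of $\Omega$. For a random persistence diagram, $\mathbb E[\mu]$ is the measure $A\mapsto\mathbb E[\mu(A)]$, and its Lebesgue density $p$ on $\Omega$ (assumed to exist) is the persistence intensity function. The empirical averaged persistence measure is $\bar\mu_n=\frac1n\sum_{i=1}^n\mu_i$. Kernel conditions (K) on $K:\mathbb R^2\to\mathbb R$: $K(\bm x)=0$ when $\|\bm x\|_2>1$; $\|K\|_\infty=\sup|K|<\infty$; $\int_{\mathbb R^2}K=1$; $\|K\|_2^2=\int_{\mathbb R^2}K^2<\infty$; there is a positive integer $s$ with $\int x_1^{s_1}x_2^{s_2}K(\bm x)\,\mathrm d\bm x=0$ for all non-negative integers $s_1,s_2$ with $1\le s_1+s_2<s$; $K$ is $L_K$-Lipschitz in the Euclidean norm. For bandwidth $h>0$, $K_h(\bm x)=h^{-2}K(\bm x/h)$. For a measure $\nu$ on $\Omega$, its persistence surface with weight function $f$ is $$\rho_h(\nu)(\bm u)=\int_\Omega f(\bm\omega)K_h(\bm u-\bm\omega)\,\mathrm d\nu(\bm\omega).$$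
   Formalization: The bound is proved for δ and h with δh² ≤ κ, where κ in (0,1) is fixed but arbitrary and C may also depend on κ; without this the logarithm can be negative or tend to 0 and the claim fails, e.g. for n = 1, h = 1, δ → 1. *)

(* Defs.v *)
From HB Require Import structures.
From mathcomp Require Import all_boot all_order all_algebra.
From mathcomp Require Import all_classical all_reals all_analysis.
From mathcomp Require Import measurable_realfun.

Set Implicit Arguments.
Unset Strict Implicit.
Unset Printing Implicit Defensive.

Import Order.TTheory GRing.Theory Num.Theory.
Import numFieldNormedType.Exports.

Local Open Scope classical_set_scope.
Local Open Scope ring_scope.

(* The norm the library puts on R * R is the sup norm. *)
Definition l2norm (R : realType) (x : R * R) : R :=
  Num.sqrt (x.1 ^+ 2 + x.2 ^+ 2).

Definition Omega (R : realType) (L : R) : set (R * R) :=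
  [set w | [/\ 0 < w.1, w.1 < w.2 & w.2 <= L]].

(* The part of the boundary of [Omega L] that lies on the diagonal. *)
Definition diagonal (R : realType) (L : R) : set (R * R) :=
  [set x | x.1 = x.2 /\ 0 <= x.1 <= L].

(* The infimum is a minimum, [diagonal L] being compact, nonempty if 0 <= L. *)
Definition dist_diagonal (R : realType) (L : R) (w : R * R) : R :=
  inf [set l2norm (w - x) | x in diagonal L].

Definition supnorm (R : realType) (T : Type) (D : set T) (g : T -> R) : \bar R :=
  ereal_sup [set `|g x|%:E | x in D].

(* The points of [plane R] are those of R * R; [measurableTypeR R] is R with the
   Borel sigma-algebra on which the library defines the Lebesgue measure. *)
Notation plane R := (measurableTypeR R * measurableTypeR R)%type.

Definition leb2 (R : realType) : {measure set (plane R) -> \bar R} :=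
  (@lebesgue_measure R \x @lebesgue_measure R)%E.

Record kernel_conditions (R : realType) (K : R * R -> R) (LK : R) : Prop := {
  kernel_support : forall x, 1 < l2norm x -> K x = 0 ;
  kernel_bounded : (supnorm setT K < +oo)%E ;
  kernel_mass : (\int[@leb2 R]_x (K x)%:E = 1)%E ;
  kernel_L2 : (\int[@leb2 R]_x ((K x) ^+ 2)%:E < +oo)%E ;
  kernel_moments : exists2 s : nat, (0 < s)%N &
    forall s1 s2 : nat, (1 <= s1 + s2)%N -> (s1 + s2 < s)%N ->
      (\int[@leb2 R]_x (x.1 ^+ s1 * x.2 ^+ s2 * K x)%:E = 0)%E ;
  kernel_lipschitz : forall x y, `|K x - K y| <= LK * l2norm (x - y)
}.

Definition rescale (R : realType) (K : R * R -> R) (h : R) (x : R * R) : R :=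
  h ^- 2 * K (x.1 / h, x.2 / h).

Definition persistence_surface (R : realType) (L : R) (f K : R * R -> R) (h : R)
    (nu : {measure set (plane R) -> \bar R}) (u : R * R) : R :=
  \int[nu]_(w in Omega L) (f w * rescale K h (u - w)).

(* A multiset of points of [Omega L] is a countable family [r] of points,
   indexed by an arbitrary (finite or infinite) set [I] of naturals. *)
Definition is_persistence_measure (R : realType) (L : R)
    (m : {measure set (plane R) -> \bar R}) : Prop :=
  exists (I : set nat) (r : nat -> R * R),
    (forall i, I i -> Omega L (r i)) /\
    (forall A, measurable A -> m A = \esum_(i in I) \d_(r i) A)%E.

Section mean_measure.
Local Open Scope ereal_scope.
Context d d' (T : measurableType d) (Y : measurableType d') (R : realType).
Variables (P : {measure set T -> \bar R}) (mu : R.-ker T ~> Y).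

Definition mean_measure (A : set Y) : \bar R := \int[P]_w mu w A.

Let mean_measure0 : mean_measure set0 = 0.
Proof.
by rewrite /mean_measure (eq_integral (cst 0)) ?integral0// => w _; rewrite measure0.
Qed.

Let mean_measure_ge0 A : 0 <= mean_measure A.
Proof. exact: integral_ge0. Qed.

Let mean_measure_sigma_additive : semi_sigma_additive mean_measure.
Proof.
move=> F mF tF mUF.
rewrite [X in _ --> X](_ : _ = \int[P]_w (\sum_(n <oo) mu w (F n))); last first.
  by apply: eq_integral => w _; rewrite measure_semi_bigcup.
apply/cvg_closeP; split.
  by apply: is_cvg_nneseries => n _ _; exact: integral_ge0.
by rewrite closeE// integral_nneseries// => n; exact: measurable_kernel.
Qed.

HB.instance Definition _ := isMeasure.Build _ _ _ mean_measure
  mean_measure0 mean_measure_ge0 mean_measure_sigma_additive.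

End mean_measure.

Section empirical_measure.
Local Open Scope ereal_scope.
Context d (Y : measurableType d) (R : realType) (n : nat).
Variable m : 'I_n -> {measure set Y -> \bar R}.

Definition empirical_measure (A : set Y) : \bar R :=
  (n%:R^-1)%:E * \sum_(i < n) m i A.

Let empirical_measure0 : empirical_measure set0 = 0.
Proof. by rewrite /empirical_measure big1 ?mule0// => i _; rewrite measure0. Qed.

Let empirical_measure_ge0 A : 0 <= empirical_measure A.
Proof. by apply: mule_ge0; [rewrite lee_fin invr_ge0|exact: sume_ge0]. Qed.

Let empirical_measure_sigma_additive : semi_sigma_additive empirical_measure.
Proof.
move=> F mF tF mUF; rewrite [X in X @ _](_ : _ =
    (fun k => (n%:R^-1)%:E * \sum_(i < n) \sum_(0 <= j < k) m i (F j))); last first.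
  apply/funext => k; rewrite exchange_big/= ge0_sume_distrr// => j _.
  exact: sume_ge0.
apply: cvgeZl => //; apply: cvg_nnesum => i _.
  by near=> k; exact: sume_ge0.
exact: measure_semi_sigma_additive.
Unshelve. all: by end_near. Qed.

HB.instance Definition _ := isMeasure.Build _ _ _ empirical_measure
  empirical_measure0 empirical_measure_ge0 empirical_measure_sigma_additive.

End empirical_measure.

(* The evaluation sigma-algebra on measures: the smallest one that makes
   m |-> m A measurable for all measurable A. *)
Definition evaluation_sigma_algebra d (Y : measurableType d) (R : realType) :
    set (set {measure set Y -> \bar R}) :=
  <<s [set E : set {measure set Y -> \bar R} | exists (A : set Y) (B : set (\bar R)),
         [/\ measurable A, measurable B & E = [set m : {measure set Y -> \bar R} | B (m A)]] ] >>.

Definition same_law d d' d0 (T : measurableType d) (T' : measurableType d')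
    (Y : measurableType d0) (R : realType)
    (P : probability T R) (mu : R.-ker T ~> Y)
    (P' : probability T' R) (mu' : R.-ker T' ~> Y) : Prop :=
  forall E, evaluation_sigma_algebra E ->
    P [set w | E (mu w)] = P' [set w | E (mu' w)].

Definition independent_measures d d0 (T : measurableType d)
    (Y : measurableType d0) (R : realType) (P : probability T R) (n : nat)
    (mu : 'I_n -> R.-ker T ~> Y) : Prop :=
  forall (J : {set 'I_n}) (E : 'I_n -> set {measure set Y -> \bar R}),
    (forall i, i \in J -> evaluation_sigma_algebra (E i)) ->
    (P [set w | forall i, i \in J -> E i (mu i w)] =
     \prod_(i in J) P [set w | E i (mu i w)])%E.

Definition is_intensity d (T : measurableType d) (R : realType) (L : R)
    (P : probability T R) (mu : R.-ker T ~> plane R) (p : R * R -> R) : Prop :=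
  [/\ measurable_fun (Omega L) p,
      forall w, Omega L w -> 0 <= p w &
      forall A, measurable A -> A `<=` Omega L ->
        (mean_measure P mu A = \int[@leb2 R]_(w in A) (p w)%:E)%E].

(* The event [A] need not be measurable itself (it may involve a supremum over
   an uncountable set), hence the measurable [E]. *)
Definition with_probability_at_least d (T : measurableType d) (R : realType)
    (P : probability T R) (a : R) (A : set T) : Prop :=
  exists2 E : set T, measurable E /\ E `<=` A & (a%:E <= P E)%E.

(* Main.v *)
(* The weight makes the integrals of [f K_h(u - .)] against the random measures
   bounded by M |K|_oo / h^2, with variance of order 1 / h^2 because f p is
   bounded and K_h is supported in a ball of radius h. For h < 1, Bernstein's
   inequality controls the deviation at the points of a grid of mesh about h^2,
   and dyadic chaining with Hoeffding's inequality extends this to all u: the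
   increments along a link of length h^2 / 2^j are at most of order
   1 / (h 2^j), so that they contribute a geometric series in sqrt(1 / (n h^2))
   and no factor log n appears. For h >= 1 Hoeffding's inequality is enough also
   on the grid: its bound then has a spare factor 1 / h, which absorbs the
   difference between log(1 / delta) and log(1 / (delta h^2)). *)
Require Import Defs.
From HB Require Import structures.
From mathcomp Require Import all_boot all_order all_algebra.
From mathcomp Require Import all_classical all_reals all_analysis.
From mathcomp Require Import measurable_realfun finmap ring lra.

Set Implicit Arguments.
Unset Strict Implicit.
Unset Printing Implicit Defensive.

Import Order.TTheory GRing.Theory Num.Theory.
Import numFieldNormedType.Exports.

Local Open Scope classical_set_scope.
Local Open Scope ring_scope.

(** The random measures are read as points of one measurable space with common law [kernel_law], so
    that the concentration bounds concern real functions of independent points. These functions are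
    truncated where the moment reaches [M], so their size and Lipschitz bounds hold everywhere; only
    a null event is lost. Independence is given for events, and a monotone class argument turns it
    into the factorisation of exponential moments.

    The union bound fixes the constants. A grid of mesh about h^2 has about h^-4 points, and with
    [l] = log(1 / (delta h^2)) the exponent [2 l] gives exp(- 2 l) = delta^2 h^4, which pays for all
    of them. The numerical factors that remain are paid by a further multiple of [l]; this works
    because [l] is at least [l0] = log(1 / [kappa]) > 0, and it is why the constant depends on
    [kappa] and grows as [kappa] tends to 1.

    No limit is taken along the chain: beyond a finite level, depending on n, a deterministic bound
    is already below the target. *)

(** * Monotone class arguments for integral-like functionals *)

Section positive_functionals.
Local Open Scope ereal_scope.
Context d (T : measurableType d) (R : realType).

(* The abstract properties of the integral of a nonnegative function; such a
   functional is determined by its values on indicators. *)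
Record positive_functional (I : (T -> \bar R) -> \bar R) : Prop := {
  functionalD : forall f g, measurable_fun setT f -> measurable_fun setT g ->
    (forall x, 0 <= f x) -> (forall x, 0 <= g x) ->
    I (fun x => f x + g x) = I f + I g ;
  functionalZ : forall (c : R) f, (0 <= c)%R -> measurable_fun setT f ->
    (forall x, 0 <= f x) -> I (fun x => c%:E * f x) = c%:E * I f ;
  functional_cvg : forall (g : nat -> T -> \bar R) f,
    (forall n, measurable_fun setT (g n)) -> (forall n x, 0 <= g n x) ->
    (forall x, {homo g ^~ x : m n / (m <= n)%N >-> m <= n}) ->
    (forall x, g ^~ x @ \oo --> f x) ->
    I (g n) @[n --> \oo] --> I f
}.

Import HBNNSimple.

(** Additivity and homogeneity carry the agreement from indicators to simple functions, and monotone
    convergence carries it to [f]. Working with functionals lets one argument serve product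
    expectations, mean and empirical measures, and densities. *)
Lemma eq_positive_functional (I J : (T -> \bar R) -> \bar R) :
  positive_functional I -> positive_functional J ->
  (forall A, measurable A ->
    I (fun x => (\1_A x)%:E) = J (fun x => (\1_A x)%:E)) ->
  forall f, measurable_fun setT f -> (forall x, 0 <= f x) -> I f = J f.
Proof.
move=> pI pJ IJ f mf f0.
pose g := nnsfun_approx measurableT mf.
have mi A : measurable A -> measurable_fun setT (fun x : T => (\1_A x : R)%:E).
  by move=> mA; exact/measurable_EFinP/measurable_indic.
have m0 : measurable_fun setT (fun _ : T => 0 : \bar R) by exact: measurable_cst.
have zero K : positive_functional K -> K (fun=> 0) = 0.
  move=> pK; rewrite (_ : (fun=> 0) = (fun x => 0%R%:E * (fun=> 0) x)).
    by rewrite (functionalZ pK)// mul0e.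
  by apply/funext => x; rewrite mul0e.
have simple (h : {nnsfun T >-> R}) : I (EFin \o h) = J (EFin \o h).
  rewrite (_ : EFin \o h = fun x =>
    \sum_(r <- enum_fset (fset_set (range h))) (r * \1_(h @^-1` [set r]) x)%:E); last first.
    apply/funext => x /=; rewrite {1}(fimfunE h x) fsbig_finite//=.
    by rewrite sumEFin.
  have nn r : r \in enum_fset (fset_set (range h)) -> (0 <= r)%R.
    by move=> rh; have := (rh : r \in fset_set (range h));
    rewrite in_fset_set // => /set_mem [x _ <-].
  elim: (enum_fset _) nn => [_|r s ih nn].
    rewrite (_ : (fun x => _) = (fun=> 0)); first by rewrite !zero.
    by apply/funext => x; rewrite big_nil.
  have r0 : (0 <= r)%R by apply: nn; rewrite mem_head.
  have ns t : t \in s -> (0 <= t)%R by move=> ts; apply: nn; rewrite inE ts orbT.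
  have mh t : measurable (h @^-1` [set t]) by exact: measurable_sfunP.
  have ms : measurable_fun setT
      (fun x => \sum_(t <- s) (t * \1_(h @^-1` [set t]) x)%:E).
    apply: emeasurable_sum => t; apply/measurable_EFinP.
    by apply: measurable_funM => //; exact: measurable_indic.
  have s0 x : 0 <= \sum_(t <- s) (t * \1_(h @^-1` [set t]) x)%:E.
    rewrite big_seq; apply: sume_ge0 => t ts.
    by rewrite lee_fin mulr_ge0// ns.
  have mr : measurable_fun setT (fun x => r%:E * (\1_(h @^-1` [set r]) x)%:E).
    by apply: measurable_funeM; exact: mi.
  have r0' x : 0 <= r%:E * (\1_(h @^-1` [set r]) x)%:E.
    by rewrite -EFinM lee_fin mulr_ge0.
  rewrite (_ : (fun x => _) = fun x => r%:E * (\1_(h @^-1` [set r]) x)%:E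
      + \sum_(t <- s) (t * \1_(h @^-1` [set t]) x)%:E); last first.
    by apply/funext => x; rewrite big_cons.
  by rewrite (functionalD pI)// (functionalD pJ)// ih// (functionalZ pI)//
    ?(functionalZ pJ)// ?IJ//; exact: mi.
have mg n : measurable_fun setT (EFin \o g n) by exact/measurable_EFinP.
have g0 n x : 0 <= (EFin \o g n) x by rewrite lee_fin.
have ndg x : {homo (fun n => (EFin \o g n) x) : m n / (m <= n)%N >-> m <= n}.
  by move=> m n mn; rewrite lee_fin; exact/lefP/nd_nnsfun_approx.
have gf x : (EFin \o g n) x @[n --> \oo] --> f x.
  by apply: cvg_nnsfun_approx => // ? _.
have := functional_cvg pI mg g0 ndg gf.
under eq_fun do rewrite simple.
move=> /cvg_lim <-//.
by apply/cvg_lim => //; exact: (functional_cvg pJ mg g0 ndg gf).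
Qed.

(** The weight [Z] stands for the remaining factors of a product in [expectation_prod], and for an
    indicator or a density in [integral_intensity]. *)
Lemma integral_positive_functional d' (S : measurableType d')
    (P : {measure set S -> \bar R}) (Phi : S -> T) (Z : S -> R) :
  measurable_fun setT Phi -> measurable_fun setT Z -> (forall w, 0 <= Z w)%R ->
  positive_functional (fun g => \int[P]_w (g (Phi w) * (Z w)%:E)).
Proof.
move=> mPhi mZ Z0.
have mE f : measurable_fun setT f ->
    measurable_fun setT (fun w => f (Phi w) * (Z w)%:E).
  move=> mf; apply: emeasurable_funM; first exact: (measurableT_comp mf).
  exact/measurable_EFinP.
have E0 f : (forall x, 0 <= f x) -> forall w, 0 <= f (Phi w) * (Z w)%:E.
  by move=> f0 w; rewrite mule_ge0// lee_fin.
split=> [f g mf mg f0 g0|c f c0 mf f0|g f mg g0 ndg gf].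
- rewrite -ge0_integralD//; [|by move=> *; exact: E0|exact: mE|
    by move=> *; exact: E0|exact: mE].
  by apply: eq_integral => w _; rewrite ge0_muleDl.
- rewrite -ge0_integralZl//; [|exact: mE|by move=> *; exact: E0].
  by apply: eq_integral => w _; rewrite muleA.
- rewrite [X in _ --> X](_ : _ =
      \int[P]_w limn (fun n => g n (Phi w) * (Z w)%:E)); last first.
    apply: eq_integral => w _; apply/esym/cvg_lim => //.
    by apply: cvgeZr => //; exact: gf.
  apply: cvg_monotone_convergence => //.
  + by move=> n; exact: mE.
  + by move=> n w _; exact: E0.
  + by move=> w _ m n mn; apply: lee_wpmul2r; [rewrite lee_fin|exact: ndg].
Qed.

Lemma iterated_integral_positive_functional d' (S : measurableType d')
    (P : {measure set S -> \bar R}) (k : R.-ker S ~> T) :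
  positive_functional (fun g => \int[P]_w \int[k w]_x g x).
Proof.
have mE f : measurable_fun setT f -> (forall x, 0 <= f x) ->
    measurable_fun setT (fun w => \int[k w]_x f x).
  move=> mf f0; apply: measurable_fun_integral_kernel => //.
  by move=> U mU; exact: measurable_kernel.
have E0 f : (forall x, 0 <= f x) -> forall w, 0 <= \int[k w]_x f x.
  by move=> f0 w; apply: integral_ge0.
split=> [f g mf mg f0 g0|c f c0 mf f0|g f mg g0 ndg gf].
- rewrite -ge0_integralD//; [|by move=> *; exact: E0|exact: mE|
    by move=> *; exact: E0|exact: mE].
  by apply: eq_integral => w _; rewrite -ge0_integralD.
- rewrite -ge0_integralZl//; [|exact: mE|by move=> *; exact: E0].
  by apply: eq_integral => w _; rewrite -ge0_integralZl.
- have lim_g w : \int[k w]_x f x = limn (fun n => \int[k w]_x g n x).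
    rewrite -monotone_convergence//.
    by apply: eq_integral => x _; apply/esym/cvg_lim => //; exact: gf.
  rewrite (eq_integral (fun w => limn (fun n => \int[k w]_x g n x))); last first.
    by move=> w _; exact: lim_g.
  apply: cvg_monotone_convergence => //.
  + by move=> n; exact: mE.
  + by move=> n w _; exact: E0.
  + by move=> w _ m n mn; apply: ge0_le_integral => //= x _; exact: ndg.
Qed.

End positive_functionals.

(** * Expectations of products of functions of independent points *)

Section independent_products.
Context d d' (T : measurableType d) (S : measurableType d') (R : realType).
Variables (P : probability T R) (Q : probability S R) (n : nat).
Variable Phi : 'I_n -> T -> S.
Hypothesis mPhi : forall i, measurable_fun setT (Phi i).
Hypothesis indep : forall A : 'I_n -> set S, (forall i, measurable (A i)) ->
  (P [set w | forall i, A i (Phi i w)] = \prod_(i < n) Q (A i))%E.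

Lemma prod_measurable (s : seq 'I_n) (Y : 'I_n -> S -> R) (p : pred 'I_n) :
  (forall i, measurable_fun setT (Y i)) ->
  measurable_fun setT (fun w => \prod_(i <- s | p i) Y i (Phi i w)).
Proof.
move=> mY; elim: s => [|i s ih].
  by under eq_fun do rewrite big_nil; exact: measurable_cst.
under eq_fun do rewrite big_cons.
by case: (p i) => //; apply: measurable_funM => //; exact: measurableT_comp.
Qed.

(** For indicators this is [indep]. The factors are then made arbitrary one at a time, all others
    being held fixed. Finiteness matters because the right side uses real-valued integrals, in which
    an infinite value would be read as 0. *)
Lemma expectation_prod (Y : 'I_n -> S -> R) :
  (forall i, measurable_fun setT (Y i)) -> (forall i x, 0 <= Y i x) ->
  (forall i, \int[Q]_x (Y i x)%:E < +oo)%E ->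
  (\int[P]_w (\prod_(i < n) Y i (Phi i w))%:E =
   (\prod_(i < n) \int[Q]_x Y i x)%:E)%E.
Proof.
(* The factors of index below [k] are arbitrary, the others are indicators. *)
suff H k : (k <= n)%N -> forall Y : 'I_n -> S -> R,
    (forall i, measurable_fun setT (Y i)) -> (forall i x, 0 <= Y i x) ->
    (forall i, \int[Q]_x (Y i x)%:E < +oo)%E ->
    (forall i : 'I_n, (k <= i)%N -> exists2 A, measurable A & Y i = \1_A) ->
    (\int[P]_w (\prod_(i < n) Y i (Phi i w))%:E =
     (\prod_(i < n) \int[Q]_x Y i x)%:E)%E.
  move=> mY Y0 Yoo; apply: (H n) => // i.
  by rewrite leqNgt ltn_ord.
elim: k => [_ {}Y mY Y0 Yoo YA|k ih kn {}Y mY Y0 Yoo YA].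
  have /choice[A HA] : forall i, exists A, measurable A /\ Y i = \1_A.
    by move=> i; have [A mA YiA] := YA i isT; exists A.
  under eq_integral => w _.
    rewrite (_ : (\prod_(i < n) _) = \1_[set w | forall i, A i (Phi i w)] w).
      over.
    under eq_bigr do rewrite (HA _).2.
    rewrite [RHS]indicE; case: (boolP (_ \in _)) => [/set_mem wA|wA].
      by rewrite big1 // => i _; rewrite indicE mem_set.
    have [i Ai] : exists i, ~ A i (Phi i w).
      by apply: contrapT => /forallNP H; move/negP: wA; apply; apply/mem_set => i;
        apply: contrapT; exact: H.
    by rewrite (bigD1 i)//= indicE memNset// mul0r.
  have mE : measurable [set w | forall i, A i (Phi i w)].
    rewrite (_ : [set w | _] = \bigcap_i (Phi i @^-1` A i)); last first.
      by apply/seteqP; split=> w /= h i => [_|]; exact: h.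
    apply: fin_bigcap_measurable => [|i _]; first exact: finite_finset.
    by rewrite -[X in measurable X]setTI; apply: mPhi => //; exact: (HA i).1.
  rewrite integral_indic// setIT; apply: (etrans (indep (fun i => (HA i).1))).
  rewrite -(@prodEFin _ _ (index_enum 'I_n) xpredT).
  apply: eq_bigr => i _.
  by rewrite (HA i).2 /Rintegral integral_indic ?setIT ?fineK//;
    [exact: fin_num_measure (HA i).1|exact: (HA i).1].
pose i0 : 'I_n := Ordinal kn.
pose Z w := \prod_(i < n | i != i0) Y i (Phi i w).
pose c := \prod_(i < n | i != i0) \int[Q]_x Y i x.
have mZ : measurable_fun setT Z by exact: prod_measurable.
have Z0 w : 0 <= Z w by exact: prodr_ge0.
have c0 : 0 <= c by apply: prodr_ge0 => i _; apply: Rintegral_ge0.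
(* Both sides as functionals of the factor at [i0]: the other factors form the weight [Z] on the
   left and the constant [c] on the right. *)
have key := eq_positive_functional
  (integral_positive_functional P (mPhi i0) mZ Z0)
  (integral_positive_functional Q (@measurable_id _ S setT)
     (@measurable_cst _ _ _ _ setT c) (fun=> c0)).
transitivity (\int[Q]_x ((Y i0 x)%:E * c%:E))%E; last first.
  rewrite (bigD1 i0)//= -/c EFinM /Rintegral ge0_integralZr//.
  - by rewrite fineK// ge0_fin_numE ?Yoo// integral_ge0// => x _; rewrite lee_fin.
  - exact/measurable_EFinP.
  - by move=> x _; rewrite lee_fin.
rewrite -[RHS](key _ (EFin \o Y i0)) /=; last 3 first.
- move=> A mA.
  (* With an indicator at [i0], whose index is [k], the induction hypothesis applies. *)
  pose Y' i := if i == i0 then \1_A else Y i.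
  have Y'0 : Y' i0 = \1_A by rewrite /Y' eqxx.
  have Y'N i : i != i0 -> Y' i = Y i by rewrite /Y' => /negbTE ->.
  have Q1 : (\int[Q]_x (\1_A x)%:E < +oo)%E.
    by rewrite integral_indic// setIT ltey_eq fin_num_measure.
  have := ih (ltnW kn) Y'; rewrite (bigD1 i0)//= Y'0.
  rewrite (eq_bigr (fun i => \int[Q]_x Y i x)) -/c; last first.
    by move=> i ii0; rewrite Y'N.
  rewrite ge0_integralZr//; last exact/measurable_EFinP/measurable_indic.
  rewrite EFinM /Rintegral fineK; last by rewrite ge0_fin_numE ?integral_ge0.
  move=> <-; first last.
  + move=> i; rewrite leq_eqVlt => /predU1P[ki|ki].
      exists A => //; rewrite /Y' ifT//; exact/eqP/val_inj.
    have [B mB YB] := YA _ ki; exists B => //.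
    by rewrite /Y' ifF//; apply/eqP => ii; rewrite ii /= ltnn in ki.
  + by move=> i; rewrite /Y'; case: ifP.
  + by move=> i x; rewrite /Y'; case: ifP.
  + by move=> i; rewrite /Y'; case: ifP => // _; exact: measurable_indic.
  apply: eq_integral => w _.
  rewrite (bigD1 i0)//= Y'0 EFinM; congr (_ * _%:E)%E.
  by apply: eq_bigr => i ii0; rewrite Y'N.
- exact/measurable_EFinP.
- by move=> x; rewrite lee_fin.
by apply: eq_integral => w _; rewrite (bigD1 i0)//= EFinM.
Qed.

End independent_products.

(** * Events of high probability and union bounds *)

Section likely.
Context d (T : measurableType d) (R : realType) (P : probability T R).
Implicit Types (A B : set T) (r s : R).

(** Phrased by the failure probability, so that union bounds become sums; the inner set [E] allows
    for a nonmeasurable [A]. *)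
Definition likely r A :=
  exists2 E : set T, measurable E /\ E `<=` A & (P (~` E) <= r%:E)%E.

Lemma likelyS r s A B : r <= s -> A `<=` B -> likely r A -> likely s B.
Proof.
move=> rs AB [E [mE EA] Er]; exists E; first by split=> // w /EA /AB.
by rewrite (le_trans Er)// lee_fin.
Qed.

Lemma likelyI r s A B : likely r A -> likely s B -> likely (r + s) (A `&` B).
Proof.
move=> [E [mE EA] Er] [F [mF FB] Fs]; exists (E `&` F).
  by split; [exact: measurableI|move=> w [/EA ? /FB]].
rewrite setCI (le_trans (measureU2 _ _ _))//; try exact: measurableC.
by rewrite EFinD leeD.
Qed.

Lemma likelyT : likely 0 setT.
Proof. by exists setT => //; rewrite setCT measure0. Qed.

Lemma likely_forall r (N : nat) (A : nat -> set T) :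
  (forall k, (k < N)%N -> likely r (A k)) ->
  likely (N%:R * r) [set w | forall k, (k < N)%N -> A k w].
Proof.
elim: N => [_|N ih H].
  by rewrite mul0r; apply: likelyS likelyT.
have := likelyI (ih (fun k kN => H k (ltnW kN))) (H N (ltnSn N)).
apply: likelyS; first by rewrite -[X in _ + X]mul1r -mulrDl -natr1.
by move=> w [h hN] k; rewrite ltnS leq_eqVlt => /predU1P[->//|]; exact: h.
Qed.

End likely.

(** * Hoeffding and Bernstein inequalities *)

Section concentration.
Context d d' (T : measurableType d) (S : measurableType d') (R : realType).
Variables (P : probability T R) (Q : probability S R) (n : nat).
Variable Phi : 'I_n -> T -> S.
Hypothesis mPhi : forall i, measurable_fun setT (Phi i).
Hypothesis indep : forall A : 'I_n -> set S, (forall i, measurable (A i)) ->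
  (P [set w | forall i, A i (Phi i w)] = \prod_(i < n) Q (A i))%E.
Hypothesis n0 : (0 < n)%N.
Implicit Types phi Y : S -> R.

Lemma integrable_bounded phi (b : R) : measurable_fun setT phi ->
  (forall x, `|phi x| <= b) -> Q.-integrable setT (EFin \o phi).
Proof.
move=> mphi phib; apply: measurable_bounded_integrable => //.
  by rewrite ltey_eq fin_num_measure.
exists b; split; first by rewrite num_real.
by move=> c bc x _ /=; rewrite (le_trans (phib x))// ltW.
Qed.

Lemma Rintegral_cst_probability (c : R) : \int[Q]_x c = c.
Proof.
rewrite Rintegral_cst//.
have -> : fine (Q setT) = 1 by rewrite (@probability_setT _ _ _ Q).
by rewrite mulr1.
Qed.

(** Squaring [1 - x / 2 <= expR (- (x / 2))] bounds [expR (- x)] from below by a polynomial whose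
    product with the quadratic is at least 1 when [x <= 1 / 2]. Negative [x] of any size are
    allowed. *)
Lemma expR_le_quad (x : R) : x <= 2^-1 -> expR x <= 1 + x + 2 * x ^+ 2.
Proof.
move=> x12; have x1 : 0 < 1 - x / 2 by lra.
have h1 : 1 - x / 2 <= expR (- (x / 2)) by exact: expR_ge1Dx.
have h2 : (1 - x / 2) ^+ 2 <= expR (- x).
  have -> : - x = - (x / 2) + - (x / 2) by field.
  rewrite expRD -expr2.
  by rewrite ler_pXn2r ?nnegrE ?expR_ge0 ?(ltW x1).
have h3 : 1 <= (1 + x + 2 * x ^+ 2) * (1 - x / 2) ^+ 2.
  rewrite -subr_ge0 (_ : _ - 1 = x ^+ 2 * (5 / 4 - 7 / 4 * x + x ^+ 2 / 2)).
    by apply: mulr_ge0; nra.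
  by field.
rewrite -[expR x]invrK -expRN -[leRHS]mul1r.
rewrite -[leLHS]mul1r ler_pdivrMr ?expR_gt0// mul1r.
apply: (le_trans h3); apply: ler_wpM2l => //; nra.
Qed.

(** Integrating [expR_le_quad] kills the linear term, since [Y] is centred; then
    [1 + t <= expR t]. *)
Lemma mgf_variance Y (B v lam : R) : measurable_fun setT Y ->
  (forall x, `|Y x| <= B) -> \int[Q]_x Y x = 0 -> \int[Q]_x (Y x ^+ 2) <= v ->
  0 <= lam -> lam * B <= 2^-1 ->
  \int[Q]_x expR (lam * Y x) <= expR (2 * lam ^+ 2 * v).
Proof.
move=> mY YB EY VY lam0 lamB.
have lY x : lam * Y x <= 2^-1.
  by apply: le_trans lamB; apply: ler_wpM2l => //; exact: le_trans (ler_norm _) (YB x).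
have mlY : measurable_fun setT (fun x => lam * Y x) by exact: measurable_funM.
have iE : Q.-integrable setT (EFin \o (fun x => expR (lam * Y x))).
  apply: (@integrable_bounded _ (expR 2^-1)).
    exact: measurableT_comp.
  by move=> x; rewrite ger0_norm ?expR_ge0// ler_expR.
have iY : Q.-integrable setT (EFin \o Y) by exact: integrable_bounded YB.
have mY2 : measurable_fun setT (fun x => Y x ^+ 2) by exact: measurable_funX.
have iY2 : Q.-integrable setT (EFin \o (fun x => Y x ^+ 2)).
  apply: (@integrable_bounded _ (B ^+ 2)) => // x.
  by rewrite normrX ler_pXn2r ?nnegrE// (le_trans _ (YB x)).
have i1 : Q.-integrable setT (EFin \o (fun=> 1 : R)).
  by apply: (@integrable_bounded _ 1) => // x; rewrite normr1.
have ilY : Q.-integrable setT (EFin \o (fun x => lam * Y x)).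
  by rewrite (_ : _ \o _ = fun x => (lam%:E * (Y x)%:E)%E)//; exact: integrableZl.
have i2Y : Q.-integrable setT (EFin \o (fun x => (2 * lam ^+ 2) * Y x ^+ 2)).
  by rewrite (_ : _ \o _ = fun x => ((2 * lam ^+ 2)%:E * (Y x ^+ 2)%:E)%E)//; exact: integrableZl.
have i1Y : Q.-integrable setT (EFin \o (fun x => 1 + lam * Y x)).
  by rewrite (_ : _ \o _ = (fun x => 1%:E + (lam * Y x)%:E)%E)//; exact: integrableD.
apply: (@le_trans _ _ (\int[Q]_x (1 + lam * Y x + (2 * lam ^+ 2) * Y x ^+ 2))).
  apply: le_Rintegral => //.
    by rewrite (_ : _ \o _ =
      (fun x => (1 + lam * Y x)%:E + ((2 * lam ^+ 2) * Y x ^+ 2)%:E)%E)//; exact: integrableD.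
  move=> x _; apply: le_trans (expR_le_quad (lY x)) _.
  by rewrite exprMn mulrA.
rewrite RintegralD// RintegralD// RintegralZl// RintegralZl// EY mulr0 addr0.
rewrite (Rintegral_cst_probability 1).
apply: le_trans (expR_ge1Dx _).
by rewrite lerD2l ler_wpM2l// mulr_ge0// exprn_ge0.
Qed.

(** A form of Hoeffding's lemma with a weaker constant. For [lam * B <= 1 / 2] it is [mgf_variance]
    with [v = B ^ 2]; otherwise [lam * B <= 2 (lam * B) ^ 2] and the bound holds pointwise. *)
Lemma mgf_bounded Y (B lam : R) : measurable_fun setT Y ->
  (forall x, `|Y x| <= B) -> \int[Q]_x Y x = 0 -> 0 <= lam ->
  \int[Q]_x expR (lam * Y x) <= expR (2 * lam ^+ 2 * B ^+ 2).
Proof.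
move=> mY YB EY lam0.
have B0 : 0 <= B by exact: le_trans (YB point).
have le_cst (f : S -> R) (c : R) : measurable_fun setT f -> (forall x, 0 <= f x <= c) ->
    \int[Q]_x f x <= c.
  move=> mf fc.
  have -> : c = \int[Q]_x (cst c x).
    by rewrite Rintegral_cst_probability.
  apply: le_Rintegral => //.
  - apply: (@integrable_bounded _ c) => // x.
    by have /andP[f0 fxc] := fc x; rewrite ger0_norm.
  - by apply: (@integrable_bounded _ `|c|).
  - by move=> x _; have /andP[] := fc x.
have [lB|lB] := leP (lam * B) 2^-1.
  apply: (mgf_variance mY YB EY _ lam0 lB).
  apply: le_cst; first exact: measurable_funX.
  by move=> x; rewrite sqr_ge0 /= -[Y x ^+ 2]real_normK ?num_real// ler_pXn2r ?nnegrE//.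
apply: le_cst; first by apply: measurableT_comp => //; exact: measurable_funM.
move=> x; rewrite expR_ge0 /= ler_expR -mulrA -exprMn.
apply: (@le_trans _ _ (lam * B)).
  by apply: ler_wpM2l => //; exact: le_trans (ler_norm _) (YB x).
by set z := lam * B in lB *; nra.
Qed.

Definition deviation phi (w : T) : R :=
  n%:R^-1 * (\sum_(i < n) phi (Phi i w)) - \int[Q]_x phi x.

Lemma measurable_deviation phi : measurable_fun setT phi ->
  measurable_fun setT (deviation phi).
Proof.
move=> mphi; apply: measurable_funB => //; apply: measurable_funM => //.
by apply: measurable_sum => i; exact: measurableT_comp.
Qed.

Lemma deviationB phi (psi : S -> R) (b c : R) : measurable_fun setT phi ->
  measurable_fun setT psi ->
  (forall x, `|phi x| <= b) -> (forall x, `|psi x| <= c) ->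
  forall w, deviation (fun x => phi x - psi x) w = deviation phi w - deviation psi w.
Proof.
move=> mphi mpsi phib psib w; rewrite /deviation sumrB mulrBr RintegralB//.
- ring.
- exact: integrable_bounded phib.
- exact: integrable_bounded psib.
Qed.

(** Markov's inequality for [expR (n lam (deviation phi))], whose expectation factorises into n
    factors, each at most [expR G]. *)
Lemma chernoff_deviation phi (b lam G t : R) : measurable_fun setT phi ->
  (forall x, `|phi x| <= b) -> 0 <= lam ->
  \int[Q]_x expR (lam * (phi x - \int[Q]_y phi y)) <= expR G ->
  likely P (expR (n%:R * (G - lam * t))) [set w | deviation phi w <= t].
Proof.
move=> mphi phib lam0 HG; set m := \int[Q]_y phi y in HG.
have n0R : (0 : R) < n%:R by rewrite ltr0n.
have mD := measurable_deviation mphi.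
pose A := [set w | t < deviation phi w].
have mA : measurable A.
  rewrite (_ : A = deviation phi @^-1` `]t, +oo[); last first.
    by apply/seteqP; split=> w /=; rewrite in_itv /= andbT.
  by rewrite -[X in measurable X]setTI; exact: mD.
exists (~` A).
  split; first exact: measurableC.
  by move=> w /= /negP; rewrite -leNgt.
rewrite setCK.
pose Y (i : 'I_n) x := expR (lam * (phi x - m)).
have mY i : measurable_fun setT (Y i).
  apply: measurableT_comp => //; apply: measurable_funM => //.
  exact: measurable_funB.
have Y0 i x : 0 <= Y i x by exact: expR_ge0.
have iY i : Q.-integrable setT (EFin \o Y i).
  apply: (@integrable_bounded _ (expR (lam * (b - m)))) => // x.
  rewrite ger0_norm ?expR_ge0// ler_expR ler_wpM2l// lerB//.
  exact: le_trans (ler_norm _) (phib x).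
have Yoo i : (\int[Q]_x (Y i x)%:E < +oo)%E.
  have /integrableP[_] := iY i.
  by under eq_integral do rewrite gee0_abs ?lee_fin ?Y0//.
have E := expectation_prod mPhi indep mY Y0 Yoo.
have DE w : \prod_(i < n) Y i (Phi i w) = expR (n%:R * lam * deviation phi w).
  rewrite -expR_sum; congr expR.
  rewrite -mulr_sumr sumrB sumr_const card_ord /deviation -/m mulrBr.
  rewrite -[m *+ n]mulr_natl mulrBr; congr (_ - _); last by ring.
  by field; rewrite gt_eqF.
have M : ((expR (n%:R * lam * t))%:E * P A <= (\prod_(i < n) \int[Q]_x Y i x)%:E)%E.
  rewrite -E.
  have -> : P A = (\int[P]_w (\1_A w)%:E)%E by rewrite integral_indic// setIT.
  rewrite -ge0_integralZl//; last exact/measurable_EFinP/measurable_indic.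
  apply: ge0_le_integral => //.
  - by apply: measurable_funeM; exact/measurable_EFinP/measurable_indic.
  - by apply/measurable_EFinP; exact: prod_measurable.
  - move=> w _; rewrite DE -EFinM lee_fin indicE.
    have [/set_mem wA|_] := boolP (w \in A); last by rewrite mulr0 expR_ge0.
    by rewrite mulr1 ler_expR ler_wpM2l ?mulr_ge0// ltW.
have -> : n%:R * (G - lam * t) = - (n%:R * lam * t) + n%:R * G by ring.
rewrite expRD.
rewrite -(@lee_pmul2l _ (expR (n%:R * lam * t))%:E)//; last by rewrite lte_fin expR_gt0.
rewrite -EFinM mulrA -expRD subrr expR0 mul1r.
apply: (le_trans M); rewrite lee_fin.
have -> : expR (n%:R * G) = \prod_(i < n) expR G.
  by rewrite prodr_const card_ord -expRM_natl mulrC.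
apply: ler_prod => i _; rewrite HG andbT.
by apply: Rintegral_ge0.
Qed.

Lemma deviation_le phi (b : R) w : measurable_fun setT phi ->
  (forall x, `|phi x| <= b) -> `|deviation phi w| <= 2 * b.
Proof.
move=> mphi phib; rewrite mulr_natl mulr2n.
apply: (le_trans (ler_normB _ _)); apply: lerD.
  rewrite normrM ger0_norm ?invr_ge0// mulrC ler_pdivrMr ?ltr0n//.
  apply: (le_trans (ler_norm_sum _ _ _)).
  rewrite (_ : b * _ = \sum_(i < n) b); first exact: ler_sum.
  by rewrite sumr_const card_ord mulr_natr.
apply: (le_trans (le_normr_Rintegral _ _)) => //.
  exact: integrable_bounded phib.
rewrite -[leRHS]Rintegral_cst_probability; apply: le_Rintegral => //.
- apply: (@integrable_bounded _ b); first exact: measurableT_comp.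
  by move=> x; rewrite normr_id.
- by apply: (@integrable_bounded _ `|b|).
Qed.

(** The exponential bound is requested for a class of [Y] that contains both [phi] minus its mean
    and the negative of this: centring at most doubles the bound [b] and does not increase the
    second moment. *)
Lemma likely_deviation phi (b lam G t : R) : measurable_fun setT phi ->
  (forall x, `|phi x| <= b) -> 0 <= lam ->
  (forall Y, measurable_fun setT Y -> (forall x, `|Y x| <= 2 * b) ->
    \int[Q]_x Y x = 0 -> \int[Q]_x Y x ^+ 2 <= \int[Q]_x phi x ^+ 2 ->
    \int[Q]_x expR (lam * Y x) <= expR G) ->
  likely P (2 * expR (n%:R * (G - lam * t))) [set w | `|deviation phi w| <= t].
Proof.
move=> mphi phib lam0 HG; set m := \int[Q]_y phi y.
have iphi : Q.-integrable setT (EFin \o phi) by exact: integrable_bounded phib.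
have b0 : 0 <= b by exact: le_trans (phib point).
have ic (c : R) : Q.-integrable setT (EFin \o (fun=> c)).
  by apply: (@integrable_bounded _ `|c|).
have mb : `|m| <= b.
  apply: (le_trans (le_normr_Rintegral _ _)) => //.
  rewrite -[leRHS]Rintegral_cst_probability; apply: le_Rintegral => //.
  apply: (@integrable_bounded _ b); first exact: measurableT_comp.
  by move=> x; rewrite normr_id.
have mphi2 : measurable_fun setT (fun x => phi x ^+ 2) by exact: measurable_funX.
have i2 : Q.-integrable setT (EFin \o (fun x => phi x ^+ 2)).
  apply: (@integrable_bounded _ (b ^+ 2)) => // x.
  by rewrite normrX ler_pXn2r ?nnegrE.
have variance : \int[Q]_x (phi x - m) ^+ 2 <= \int[Q]_x phi x ^+ 2.
  have -> : \int[Q]_x (phi x - m) ^+ 2 =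
      \int[Q]_x (phi x ^+ 2 + ((- (2 * m)) * phi x + m ^+ 2)).
    by apply: eq_Rintegral => x _; ring.
  have iZ : Q.-integrable setT (EFin \o (fun x => - (2 * m) * phi x)).
    rewrite (_ : _ \o _ = fun x => ((- (2 * m))%:E * (phi x)%:E)%E)//.
    exact: integrableZl.
  rewrite RintegralD//; last first.
    by rewrite (_ : _ \o _ =
      (fun x => (- (2 * m) * phi x)%:E + (m ^+ 2)%:E)%E)//;
      exact: (integrableD measurableT iZ (ic _)).
  rewrite RintegralD// RintegralZl// Rintegral_cst_probability -/m.
  by rewrite gerDl; nra.
have H1 : \int[Q]_x expR (lam * (phi x - m)) <= expR G.
  apply: HG => //.
  - exact: measurable_funB.
  - by move=> x; rewrite mulr_natl mulr2n (le_trans (ler_normB _ _))// lerD.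
  - by rewrite RintegralB// Rintegral_cst_probability subrr.
(* The negative is written as a difference so that [deviationB] and [RintegralB] apply to it. *)
have N0 : \int[Q]_x (0 - phi x) = - m.
  by rewrite RintegralB// Rintegral_cst_probability sub0r.
have H2 : \int[Q]_x expR (lam * ((0 - phi x) - \int[Q]_x (0 - phi x))) <= expR G.
  rewrite N0; apply: HG => //.
  - by do 2! apply: measurable_funB => //.
  - move=> x; rewrite sub0r mulr_natl mulr2n (le_trans (ler_normB _ _))//.
    by rewrite !normrN lerD.
  - by rewrite RintegralB// ?Rintegral_cst_probability ?N0 ?subrr//;
      apply: (@integrable_bounded _ b) => [|x]; rewrite ?sub0r ?normrN//;
      exact: measurable_funB.
  - apply: le_trans variance; rewrite le_eqVlt; apply/orP; left; apply/eqP.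
    by apply: eq_Rintegral => x _; ring.
have L1 := chernoff_deviation t mphi phib lam0 H1.
have m0phi : measurable_fun setT (fun x => 0 - phi x) by exact: measurable_funB.
have phib' x : `|0 - phi x| <= b by rewrite sub0r normrN.
have L2 := chernoff_deviation t m0phi phib' lam0 H2.
apply: likelyS (likelyI L1 L2); first by rewrite [leRHS]mulr_natl mulr2n.
move=> w [] /=.
rewrite (@deviationB _ _ 0 b)//; last by move=> x; rewrite normr0.
rewrite ler_norml => -> ; rewrite andbT.
suff -> : deviation (fun=> 0) w = 0 by rewrite sub0r lerNl.
by rewrite /deviation big1// Rintegral_cst_probability mulr0 subrr.
Qed.

Lemma hoeffding_deviation phi (b x : R) : measurable_fun setT phi -> 0 < b ->
  (forall s, `|phi s| <= b) -> 0 <= x ->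
  likely P (2 * expR (- x)) [set w | `|deviation phi w| <= b * Num.sqrt (32 * x / n%:R)].
Proof.
move=> mphi b0 phib x0; set s := Num.sqrt _.
have n0R : (0 : R) < n%:R by rewrite ltr0n.
have sE : s ^+ 2 = 32 * x / n%:R.
  by rewrite sqr_sqrtr// mulr_ge0 ?invr_ge0// mulr_ge0.
(* This [lam] minimises [8 lam ^ 2 b ^ 2 - lam b s]; the minimum [- s ^ 2 / 32] explains the 32 in
   the threshold. *)
have lam0 : 0 <= s / (16 * b) by rewrite divr_ge0 ?sqrtr_ge0// mulr_ge0// ltW.
have := likely_deviation (G := 8 * (s / (16 * b)) ^+ 2 * b ^+ 2) (b * s) mphi phib lam0.
have -> : n%:R * (8 * (s / (16 * b)) ^+ 2 * b ^+ 2 - s / (16 * b) * (b * s)) = - x.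
  transitivity (- (n%:R * s ^+ 2 / 32)); first by field; rewrite gt_eqF.
  by rewrite sE; field; rewrite gt_eqF.
apply => Y mY Yb EY _; apply: le_trans (mgf_bounded mY Yb EY lam0) _.
by rewrite ler_expR le_eqVlt; apply/orP; left; apply/eqP; ring.
Qed.

(** The threshold makes the exponent exactly [- x]. The parameter [lam] stays free, to be balanced
    by [small_bandwidth]. *)
Lemma bernstein_deviation phi (b v lam x : R) : measurable_fun setT phi ->
  (forall s, `|phi s| <= b) -> \int[Q]_s phi s ^+ 2 <= v ->
  0 < lam -> lam * (2 * b) <= 2^-1 ->
  likely P (2 * expR (- x))
    [set w | `|deviation phi w| <= x / (n%:R * lam) + 2 * lam * v].
Proof.
move=> mphi phib phiv lam0 lamb.
have n0R : (0 : R) < n%:R by rewrite ltr0n.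
have := likely_deviation (G := 2 * lam ^+ 2 * v)
  (x / (n%:R * lam) + 2 * lam * v) mphi phib (ltW lam0).
have -> : n%:R * (2 * lam ^+ 2 * v - lam * (x / (n%:R * lam) + 2 * lam * v)) = - x.
  by field; rewrite !gt_eqF.
apply => Y mY Yb EY Yv; apply: (mgf_variance mY Yb EY _ (ltW lam0) lamb).
exact: le_trans Yv phiv.
Qed.

End concentration.

(** * Dyadic chaining over the square of side [L] *)

Section chaining.
Context d d' (T : measurableType d) (S : measurableType d') (R : realType).
Variables (P : probability T R) (Q : probability S R) (n : nat).
Variable Phi : 'I_n -> T -> S.
Hypothesis mPhi : forall i, measurable_fun setT (Phi i).
Hypothesis indep : forall A : 'I_n -> set S, (forall i, measurable (A i)) ->
  (P [set w | forall i, A i (Phi i w)] = \prod_(i < n) Q (A i))%E.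
Hypothesis n0 : (0 < n)%N.
Variables (phi : R * R -> S -> R) (L b lip : R).
Hypothesis L0 : 0 < L.
Hypothesis lip0 : 0 < lip.
Hypothesis mphi : forall u, measurable_fun setT (phi u).
Hypothesis phib : forall u s, `|phi u s| <= b.
Hypothesis phi_lip : forall u v s,
  `|phi u s - phi v s| <= lip * (`|u.1 - v.1| + `|u.2 - v.2|).

Local Notation dev := (deviation Q Phi).

Variable N0 : nat.
Hypothesis N00 : (0 < N0)%N.

Let grid_size j : nat := N0 * 2 ^ j.

(** The grid fills the whole square: the parent of a grid point of [Omega L] may lie on the
    diagonal, outside [Omega L]. *)
Let grid (j k l : nat) : R * R :=
  (L * k%:R / (grid_size j)%:R, L * l%:R / (grid_size j)%:R).

Let scale : R := lip * (L / N0%:R).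

Let N0R : (0 : R) < N0%:R. Proof. by rewrite ltr0n. Qed.

Let grid_size_gt0 j : (0 : R) < (grid_size j)%:R.
Proof. by rewrite ltr0n muln_gt0 N00 expn_gt0. Qed.

Let scale_gt0 : 0 < scale. Proof. by rewrite mulr_gt0// divr_gt0. Qed.

(** The parent of index [k] is [k./2]: the same coordinate for even [k], one fine mesh width to the
    left for odd [k]. *)
Let coord_parent j k :
  `|L * k%:R / (grid_size j.+1)%:R - L * (k./2)%:R / (grid_size j)%:R|
  <= L / N0%:R / 2 / 2 ^+ j.
Proof.
have pj : (0 : R) < 2 ^+ j by rewrite exprn_gt0.
rewrite -{1}(odd_double_half k) /grid_size expnS !natrM natrX natrD -muln2 natrM.
have -> : L * ((odd k)%:R + k./2%:R * 2) / (N0%:R * (2 * 2 ^+ j)) -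
    L * k./2%:R / (N0%:R * 2 ^+ j) = (odd k)%:R * (L / N0%:R / 2 / 2 ^+ j).
  by field; rewrite !gt_eqF.
have c0 : 0 <= L / N0%:R / 2 / 2 ^+ j by rewrite !divr_ge0// ltW.
by case: (odd k); rewrite ?mul1r ?mul0r ?normr0// ger0_norm.
Qed.

Let link j k l s :
  `|phi (grid j.+1 k l) s - phi (grid j k./2 l./2) s| <= scale / 2 ^+ j.
Proof.
apply: (le_trans (phi_lip _ _ _)).
rewrite (_ : scale / 2 ^+ j = lip * (L / N0%:R / 2 / 2 ^+ j + L / N0%:R / 2 / 2 ^+ j)).
  by rewrite ler_pM2l//; apply: lerD; exact: coord_parent.
by rewrite /scale; field; rewrite !gt_eqF// exprn_gt0.
Qed.

(** Links of level j deviate by a multiple of [sqrt (j + 1) / 2 ^ j]; this replaces it by the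
    summable [(3 / 4) ^ j]. *)
Let sqrt_le_geometric j : Num.sqrt (j.+1%:R : R) <= (3 / 2) ^+ j.
Proof.
rewrite -[leRHS]ger0_norm ?exprn_ge0 ?divr_ge0// -sqrtr_sqr ler_wsqrtr//.
elim: j => [|j ih]; first by rewrite expr0 expr1n.
have z1 : (1 : R) <= ((3 / 2) ^+ j) ^+ 2 by rewrite -exprM exprn_ege1//; lra.
rewrite (exprS _ j) exprMn -[j.+2%:R]natr1 (_ : (3 / 2) ^+ 2 = 9 / 4 :> R); last by field.
have : (0 : R) <= j%:R by [].
by move: ih z1; rewrite -![j.+1%:R]natr1; lra.
Qed.

Variables (x t0 : R).
Hypothesis x8 : expR (- x) <= 8^-1.
Hypothesis x0 : 0 < x.
Hypothesis level0 : forall u,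
  likely P (2 * expR (- x)) [set w | `|dev (phi u) w| <= t0].

Let sd := Num.sqrt (32 * x / n%:R).

Let sd_gt0 : 0 < sd.
Proof. by rewrite sqrtr_gt0 divr_gt0 ?ltr0n// mulr_gt0. Qed.

(** Links from level j to j + 1 get the Hoeffding parameter [(j + 1) x]. Each fails with probability
    at most [2 expR (- x) 8 ^ - j], by [x8], and there are at most [(N0 + 1) ^ 2 4 ^ (j + 1)] of
    them. So failures decay like [2 ^ - j] and increments like [(3 / 4) ^ j]; the statement carries
    the partial sums of both series. *)
Let chain J : likely P
  (N0.+1%:R ^+ 2 * (2 * expR (- x) + 16 * expR (- x) * (1 - (2^-1) ^+ J)))
  [set w | forall k, (k < (grid_size J).+1)%N ->
    forall l, (l < (grid_size J).+1)%N ->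
    `|dev (phi (grid J k l)) w| <= t0 + 4 * scale * sd * (1 - (3 / 4) ^+ J)].
Proof.
have e0 : 0 < expR (- x) by exact: expR_gt0.
elim: J => [|J ih].
  rewrite !expr0 subrr !mulr0 !addr0 /grid_size expn0 muln1.
  rewrite expr2 -mulrA; apply: likely_forall => k _; apply: likely_forall => l _.
  exact: level0.
have step : likely P (N0.+1%:R ^+ 2 * (8 * expR (- x) * (2^-1) ^+ J))
  [set w | forall k, (k < (grid_size J.+1).+1)%N ->
    forall l, (l < (grid_size J.+1).+1)%N ->
    `|dev (fun s => phi (grid J.+1 k l) s - phi (grid J k./2 l./2) s) w| <=
      scale * sd * (3 / 4) ^+ J].
  have H k l := hoeffding_deviation mPhi indep n0 (x := J.+1%:R * x)
    (measurable_funB (mphi (grid J.+1 k l)) (mphi (grid J k./2 l./2)))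
    (divr_gt0 scale_gt0 (exprn_gt0 J (ltr0n R 2))) (link J k l)
    (mulr_ge0 (ler0n R J.+1) (ltW x0)).
  have {}H : likely P
    ((grid_size J.+1).+1%:R * ((grid_size J.+1).+1%:R * (2 * expR (- (J.+1%:R * x)))))
    [set w | forall k, (k < (grid_size J.+1).+1)%N ->
    forall l, (l < (grid_size J.+1).+1)%N ->
    `|dev (fun s => phi (grid J.+1 k l) s - phi (grid J k./2 l./2) s) w| <=
      scale / 2 ^+ J * Num.sqrt (32 * (J.+1%:R * x) / n%:R)].
    by apply: likely_forall => k _; apply: likely_forall => l _; exact: H.
  apply: likelyS H.
    have h1 : (grid_size J.+1).+1%:R <= N0.+1%:R * 2 ^+ J.+1 :> R.
      rewrite /grid_size -natrX -natrM ler_nat mulSn addnC -addn1 leq_add2l.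
      by rewrite expn_gt0.
    have -> : expR (- (J.+1%:R * x)) = expR (- x) * expR (- x) ^+ J.
      by rewrite -exprS -expRM_natl mulrN.
    have h2 : expR (- x) ^+ J <= (8^-1) ^+ J.
      by apply: lerXn2r; rewrite ?nnegrE// ltW.
    have h4 : (2 ^+ J.+1) ^+ 2 * (8^-1) ^+ J = 4 * (2^-1) ^+ J :> R.
      rewrite (exprS _ J) exprMn -exprM mulnC exprM -mulrA -exprMn.
      rewrite (_ : 2 ^+ 2 / 8 = 2^-1 :> R); last by field.
      by rewrite (_ : 2 ^+ 2 = 4 :> R)//; ring.
    have -> : N0.+1%:R ^+ 2 * (8 * expR (- x) * (2^-1) ^+ J) =
      (N0.+1%:R * 2 ^+ J.+1) * ((N0.+1%:R * 2 ^+ J.+1) * (2 * (expR (- x) * (8^-1) ^+ J))).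
      transitivity (N0.+1%:R ^+ 2 * (2 * expR (- x)) * (4 * (2^-1) ^+ J)); first by ring.
      by rewrite -h4; ring.
    have g0 : 0 <= (grid_size J.+1).+1%:R :> R by [].
    have q0 : 0 <= 2 * (expR (- x) * expR (- x) ^+ J).
      by rewrite !mulr_ge0 ?exprn_ge0// ltW.
    apply: (ler_pM g0 (mulr_ge0 g0 q0) h1); apply: (ler_pM g0 q0 h1).
    by rewrite ler_pM2l// ler_pM2l.
  move=> w h k kJ l lJ; apply: le_trans (h k kJ l lJ) _.
  have -> : Num.sqrt (32 * (J.+1%:R * x) / n%:R) = sd * Num.sqrt J.+1%:R.
    rewrite -sqrtrM; first by congr Num.sqrt; ring.
    by rewrite divr_ge0// mulr_ge0// ltW.
  have -> : (3 / 4) ^+ J = (3 / 2) ^+ J / 2 ^+ J :> R.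
    by rewrite -exprVn -exprMn; congr (_ ^+ _); field.
  have -> : scale / 2 ^+ J * (sd * Num.sqrt J.+1%:R) =
    scale * sd * (Num.sqrt J.+1%:R / 2 ^+ J) by ring.
  by rewrite (ler_pM2l (mulr_gt0 scale_gt0 sd_gt0)) ler_pM2r ?invr_gt0 ?exprn_gt0.
have := likelyI ih step; apply: likelyS.
  by rewrite le_eqVlt; apply/orP; left; apply/eqP; rewrite (exprS _ J); field.
move=> w [h1 h2] k kJ l lJ.
have half i : (i < (grid_size J.+1).+1)%N -> (i./2 < (grid_size J).+1)%N.
  rewrite !ltnS /grid_size expnS mulnCA mul2n => /half_leq.
  by rewrite doubleK.
have := h1 _ (half _ kJ) _ (half _ lJ); have := h2 _ kJ _ lJ.
rewrite (deviationB Q Phi (mphi _) (mphi _) (phib _) (phib _)) => A B.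
rewrite -[X in `|X|](subrK (dev (phi (grid J k./2 l./2)) w)).
apply: (le_trans (ler_normD _ _)); apply: (le_trans (lerD A B)).
by rewrite le_eqVlt; apply/orP; left; apply/eqP; rewrite (exprS _ J); field.
Qed.

Let coord_grid j (y : R) : 0 <= y <= L -> exists2 k, (k < (grid_size j).+1)%N &
  `|y - L * k%:R / (grid_size j)%:R| <= L / (grid_size j)%:R.
Proof.
move=> /andP[y0 yL].
have z0 : 0 <= y * (grid_size j)%:R / L by rewrite divr_ge0 ?mulr_ge0// ltW.
have /andP[k1 k2] := truncn_itv z0.
exists (Num.truncn (y * (grid_size j)%:R / L)).
  rewrite ltnS -(ler_nat R) (le_trans k1)// ler_pdivrMr//.
  by rewrite mulrC ler_pM2l.
set k := Num.truncn _ in k1 k2 *.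
have -> : y - L * k%:R / (grid_size j)%:R =
    L / (grid_size j)%:R * (y * (grid_size j)%:R / L - k%:R).
  by field; rewrite !gt_eqF.
have c0 : 0 <= L / (grid_size j)%:R by rewrite divr_ge0// ltW.
rewrite normrM ger0_norm// ler_piMr// ger0_norm; last by rewrite subr_ge0.
by rewrite lerBlDr addrC natr1 ltW.
Qed.

(** Once [2 ^ J >= 4 / sd], replacing [u] by a nearby grid point costs at most [scale * sd] by the
    deterministic [deviation_le]. This is the fifth unit beside the four of [chain], and 18 is 2 +
    16. *)
Lemma chaining : likely P (18 * N0.+1%:R ^+ 2 * expR (- x))
  [set w | forall u, 0 <= u.1 <= L -> 0 <= u.2 <= L ->
    `|dev (phi u) w| <= t0 + 5 * (lip * (L / N0%:R)) * Num.sqrt (32 * x / n%:R)].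
Proof.
rewrite -/scale -/sd.
have [J HJ] : exists J : nat, 4 / sd <= 2 ^+ J.
  exists (Num.truncn (4 / sd)).+1; apply: (@le_trans _ _ (Num.truncn (4 / sd)).+1%:R).
    by rewrite ltW// truncnS_gt.
  by rewrite -natrX ler_nat ltnW// ltn_expl.
have e0 : 0 < expR (- x) by exact: expR_gt0.
apply: likelyS (chain J).
  rewrite [leRHS](_ : _ = N0.+1%:R ^+ 2 * (18 * expR (- x))); last by ring.
  rewrite ler_wpM2l// ?exprn_ge0//.
  have : 0 <= (2^-1 : R) ^+ J by rewrite exprn_ge0.
  by set z := _ ^+ J; nra.
move=> w h u u1 u2.
have [k kJ hk] := coord_grid J u1; have [l lJ hl] := coord_grid J u2.
have := h k kJ l lJ => B.
pose c := 2 * (scale / 2 ^+ J).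
have p0 : (0 : R) < 2 ^+ J by rewrite exprn_gt0.
have pc s : `|phi u s - phi (grid J k l) s| <= c.
  apply: (le_trans (phi_lip _ _ _)).
  rewrite (_ : c = lip * (L / (grid_size J)%:R + L / (grid_size J)%:R)).
    by rewrite ler_pM2l//; exact: lerD.
  by rewrite /c /scale /grid_size natrM natrX; field; rewrite !gt_eqF.
have A := deviation_le Q Phi n0 w (measurable_funB (mphi u) (mphi (grid J k l))) pc.
rewrite (deviationB Q Phi (mphi _) (mphi _) (phib _) (phib _)) in A.
rewrite -[X in `|X|](subrK (dev (phi (grid J k l)) w)).
apply: (le_trans (ler_normD _ _)); apply: (le_trans (lerD A B)).
have h1 : 2 * c <= scale * sd.
  rewrite /c (_ : _ * _ = scale * (4 / 2 ^+ J)); last by field; rewrite gt_eqF.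
  rewrite ler_pM2l// ler_pdivrMr// mulrC -ler_pdivrMr//.
have h2 : 0 <= scale * sd * (3 / 4) ^+ J.
  by rewrite mulr_ge0 ?exprn_ge0 ?divr_ge0// mulr_ge0// ltW.
by move: h1 h2; set z := _ ^+ J; lra.
Qed.

End chaining.

(** * Random measures as random points of a measurable space *)

Lemma positive_functional_integral d (Y : measurableType d) (R : realType)
    (nu : {measure set Y -> \bar R}) :
  positive_functional (fun h : Y -> \bar R => \int[nu]_y h y)%E.
Proof.
have := @integral_positive_functional _ Y R _ Y nu id (cst 1) (@measurable_id _ Y setT)
  (@measurable_cst _ _ Y R setT 1) (fun=> ler01).
rewrite (_ : (fun h => _) = fun h => \int[nu]_y h y)%E//.
by apply/funext => h; apply: eq_integral => y _; rewrite mule1.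
Qed.

Section measure_space.
Context d (Y : measurableType d) (R : realType).

Definition measure_space : Type := {measure set Y -> \bar R}.

HB.instance Definition _ := gen_eqMixin measure_space.
HB.instance Definition _ := gen_choiceMixin measure_space.
HB.instance Definition _ := isPointed.Build measure_space mzero.

Definition evaluation_generators : set (set measure_space) :=
  [set E | exists (A : set Y) (B : set (\bar R)),
    [/\ measurable A, measurable B & E = [set m : measure_space | B (m A)]] ].

(* Its measurable sets are those of [evaluation_sigma_algebra]. *)
Definition evaluation_space := g_sigma_algebraType evaluation_generators.

(** The identity, by which a point of [evaluation_space] is used as a measure again; it behaves as a
    kernel from that space to [Y]. *)
Definition measure_of_evaluation (m : evaluation_space) :
  {measure set Y -> \bar R} := m.

Lemma measurable_evaluation (A : set Y) : measurable A ->
  measurable_fun setT (fun m : evaluation_space => measure_of_evaluation m A).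
Proof.
move=> mA _ B mB; rewrite setTI; apply: sub_sigma_algebra.
by exists A, B.
Qed.

Lemma measurable_integral_evaluation (g : Y -> \bar R) :
  measurable_fun setT g -> (forall y, 0 <= g y)%E ->
  measurable_fun setT
    (fun m : evaluation_space => \int[measure_of_evaluation m]_y g y)%E.
Proof.
move=> mg g0; apply: measurable_fun_integral_kernel => // U mU.
exact: measurable_evaluation.
Qed.

End measure_space.

Section kernel_law.
Context d d' (T : measurableType d) (Y : measurableType d') (R : realType).
Variables (P : probability T R) (mu : R.-ker T ~> Y).

Definition kernel_evaluation (w : T) : evaluation_space Y R := mu w.

Lemma measurable_kernel_evaluation : measurable_fun setT kernel_evaluation.
Proof.
apply: (@measurability _ _ _ _ setT kernel_evaluation (@evaluation_generators _ Y R)) => //.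
move=> _ [_ [A [B [mA mB ->]]] <-]; rewrite setTI.
have := measurable_kernel mu A mA measurableT B mB.
by rewrite setTI.
Qed.

HB.instance Definition _ := isMeasurableFun.Build _ _ _ _ kernel_evaluation
  measurable_kernel_evaluation.

Definition kernel_law : probability (evaluation_space Y R) R :=
  distribution P (kernel_evaluation : {mfun T >-> evaluation_space Y R}).

(** Campbell's formula: both sides are positive functionals of [g], and on indicators they agree by
    the definition of [mean_measure]. *)
Lemma integral_mean_measure (g : Y -> \bar R) :
  measurable_fun setT g -> (forall y, 0 <= g y)%E ->
  (\int[mean_measure P mu]_y g y =
   \int[kernel_law]_m \int[measure_of_evaluation m]_y g y)%E.
Proof.
move=> mg g0.
rewrite ge0_integral_pushforward//; first last.
- by move=> m _; exact: integral_ge0.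
- exact: measurable_integral_evaluation.
rewrite preimage_setT /=.
apply: (eq_positive_functional (positive_functional_integral _)
  (iterated_integral_positive_functional P mu)) => //.
move=> A mA.
rewrite integral_indic// setIT; apply: eq_integral => w _.
by rewrite integral_indic// setIT.
Qed.

End kernel_law.

Section empirical_integral.
Context d (Y : measurableType d) (R : realType) (n : nat).
Variable m : 'I_n -> {measure set Y -> \bar R}.

Lemma integral_empirical_measure (g : Y -> \bar R) :
  measurable_fun setT g -> (forall y, 0 <= g y)%E ->
  (\int[empirical_measure m]_y g y =
   (n%:R^-1)%:E * \sum_(i < n) \int[m i]_y g y)%E.
Proof.
move=> mg g0.
have n0 : (0 <= (n%:R^-1)%:E :> \bar R)%E by rewrite lee_fin.
pose J (h : Y -> \bar R) := ((n%:R^-1)%:E * \sum_(i < n) \int[m i]_y h y)%E.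
have pJ : positive_functional J.
  split=> [f h mf mh f0 h0|c f c0 mf f0|h f mh h0 ndh hf].
  - rewrite /J -ge0_muleDr ?sume_ge0// => [|i _|i _]; try exact: integral_ge0.
    rewrite -big_split /=; congr (_ * _)%E; apply: eq_bigr => i _.
    exact: (functionalD (positive_functional_integral (m i))).
  - rewrite /J muleCA; congr (_ * _)%E.
    rewrite ge0_sume_distrr => [|i _]; last exact: integral_ge0.
    by apply: eq_bigr => i _; exact: (functionalZ (positive_functional_integral (m i))).
  - apply: cvgeZl => //; apply: cvg_nnesum => i _.
      by apply: nearW => k; exact: integral_ge0.
    exact: (functional_cvg (positive_functional_integral (m i)) mh h0 ndh hf).
apply: (eq_positive_functional (positive_functional_integral _) pJ) => // A mA.
rewrite /J integral_indic// setIT; congr (_ * _)%E; apply: eq_bigr => i _.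
by rewrite integral_indic// setIT.
Qed.

End empirical_integral.

(** * Truncated integrals and their first two moments *)

Section truncated_integral.
Context d (Y : measurableType d) (R : realType).
Variables (D : set Y) (f : Y -> R) (M : R).
Hypothesis mD : measurable D.
Hypothesis mf : measurable_fun D f.
Hypothesis f0 : forall y, D y -> 0 <= f y.
Hypothesis M0 : 0 < M.
Implicit Types (m : {measure set Y -> \bar R}) (g h : Y -> R) (c : R).

Definition moment_lt m : Prop := (\int[m]_(y in D) (f y)%:E < M%:E)%E.

(* The truncation makes the bounds below hold for every measure, not only
   almost surely. *)
Definition truncated_integral g m : R :=
  if `[< moment_lt m >] then \int[m]_(y in D) g y else 0.

Lemma measurable_EFin_restrict g : measurable_fun D g ->
  measurable_fun setT ((EFin \o g) \_ D).
Proof.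
by move=> mg; apply/(measurable_restrictT _ mD); exact/measurable_EFinP.
Qed.

Lemma measurable_integral_on (g : Y -> \bar R) : measurable_fun D g ->
  measurable_fun setT
    (fun m : evaluation_space Y R => \int[measure_of_evaluation m]_(y in D) g y)%E.
Proof.
move=> mg.
have mgD : measurable_fun setT (g \_ D) by apply/(measurable_restrictT _ mD).
rewrite (_ : (fun m => _) = fun m : evaluation_space Y R =>
    \int[measure_of_evaluation m]_y ((g \_ D)^\+ y) -
    \int[measure_of_evaluation m]_y ((g \_ D)^\- y))%E; last first.
  by apply/funext => m; rewrite integral_mkcond integralE.
by apply: emeasurable_funB; apply: measurable_integral_evaluation => //;
  [exact: measurable_funepos|exact: measurable_funeneg].
Qed.

Lemma measurable_moment_lt :
  measurable [set m : evaluation_space Y R | moment_lt m].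
Proof.
have mI : measurable_fun D (EFin \o f) by exact/measurable_EFinP.
have := measurable_integral_on mI measurableT (emeasurable_itv `]-oo, M%:E[).
rewrite setTI; congr measurable; apply/seteqP; split=> m /=;
  by rewrite in_itv.
Qed.

Lemma measurable_truncated_integral g : measurable_fun D g ->
  measurable_fun setT (truncated_integral g : evaluation_space Y R -> R).
Proof.
move=> mg; rewrite /truncated_integral.
apply: measurable_fun_ifT => //.
  apply: (measurable_fun_bool true) => //.
  rewrite setTI (_ : _ @^-1` _ = [set m : evaluation_space Y R | moment_lt m]).
    exact: measurable_moment_lt.
  by apply/seteqP; split=> m /= /asboolP.
apply: measurableT_comp; first exact: fine_measurable.
by apply: measurable_integral_on; exact/measurable_EFinP.
Qed.

Lemma moment_lt_integrable g c m : measurable_fun D g ->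
  (forall y, D y -> `|g y| <= c * f y) -> moment_lt m ->
  m.-integrable D (EFin \o g).
Proof.
move=> mg gf mM.
have i_f : m.-integrable D (EFin \o f).
  apply/integrableP; split; first exact/measurable_EFinP.
  apply: le_lt_trans (lt_trans mM (ltry _)).
  rewrite le_eqVlt; apply/orP; left; apply/eqP; apply: eq_integral => y.
  by move=> /set_mem Dy /=; rewrite ger0_norm ?f0.
have i_cf : m.-integrable D (fun y => c%:E * (f y)%:E)%E by exact: integrableZl.
apply: (le_integrable mD _ _ i_cf); first exact/measurable_EFinP.
by move=> y Dy; rewrite -EFinM lee_fin; exact: le_trans (gf y Dy) (ler_norm _).
Qed.

Lemma truncated_integral_bound g c m : measurable_fun D g -> 0 <= c ->
  (forall y, D y -> `|g y| <= c * f y) -> `|truncated_integral g m| <= c * M.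
Proof.
move=> mg c0 gf; rewrite /truncated_integral.
case: asboolP => mM; last by rewrite normr0 mulr_ge0// ltW.
have i_g := moment_lt_integrable mg gf mM.
apply: (le_trans (le_normr_Rintegral mD i_g)).
have i_f : m.-integrable D (EFin \o f).
  apply: (@moment_lt_integrable _ 1) => // y Dy.
  by rewrite mul1r ger0_norm ?f0.
apply: (@le_trans _ _ (\int[m]_(y in D) (c * f y))).
  apply: le_Rintegral => //; first exact: integrable_norm.
  by rewrite (_ : _ \o _ = fun y => c%:E * (f y)%:E)%E//; exact: integrableZl.
rewrite RintegralZl// ler_wpM2l// -lee_fin fineK; first exact: ltW.
exact: integrable_fin_num.
Qed.

Lemma truncated_integralB g h c m : measurable_fun D g -> measurable_fun D h ->
  (forall y, D y -> `|g y| <= c * f y) -> (forall y, D y -> `|h y| <= c * f y) ->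
  truncated_integral (fun y => g y - h y) m =
  truncated_integral g m - truncated_integral h m.
Proof.
move=> mg mh gc hc; rewrite /truncated_integral.
case: asboolP => mM; last by rewrite subr0.
by rewrite RintegralB//; [exact: moment_lt_integrable gc mM|exact: moment_lt_integrable hc mM].
Qed.

Variable Q : probability (evaluation_space Y R) R.
Hypothesis Q_moment : {ae Q, forall m, moment_lt m}.

(** Under [Q] the truncation takes effect on a null set only, so expectations do not see it. *)
Lemma integral_truncated h c : measurable_fun D h -> 0 <= c ->
  (forall y, D y -> 0 <= h y <= c * f y) ->
  (\int[Q]_m \int[measure_of_evaluation m]_(y in D) (h y)%:E =
   (\int[Q]_m truncated_integral h m)%:E)%E.
Proof.
move=> mh c0 hc.
have hc' y : D y -> `|h y| <= c * f y.
  by move=> Dy; have /andP[h0 ?] := hc y Dy; rewrite ger0_norm.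
have mt := measurable_truncated_integral mh.
have it : Q.-integrable setT (EFin \o truncated_integral h).
  by apply: (@integrable_bounded _ _ _ _ _ (c * M)) => // m; exact: truncated_integral_bound.
rewrite fineK; last exact: integrable_fin_num.
apply: ge0_ae_eq_integral => //.
- by apply: measurable_integral_on; exact/measurable_EFinP.
- exact/measurable_EFinP.
- move=> m _; apply: integral_ge0 => y Dy.
  by rewrite lee_fin; have /andP[] := hc y Dy.
- move=> m _; rewrite lee_fin /truncated_integral; case: asboolP => // _.
  by apply: Rintegral_ge0 => y Dy; have /andP[] := hc y Dy.
- have F : Filter (nbhs (almost_everywhere Q)) by exact: (ae_filter_ringOfSetsType Q).
  apply: filterS Q_moment => m mM _ /=.
  rewrite /truncated_integral; case: asboolP => // _.
  by rewrite /Rintegral fineK//; apply: integrable_fin_num => //;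
    exact: moment_lt_integrable hc' mM.
Qed.

(** One factor of the square is bounded by [c * M], the other is kept as an integral of [|g|]. The
    latter leads to the mean measure, hence to the intensity, and gives a variance of order h^-2
    where the sup bound alone gives h^-4. *)
Lemma truncated_integral_sqr g c : measurable_fun D g -> 0 <= c ->
  (forall y, D y -> `|g y| <= c * f y) ->
  ((\int[Q]_m (truncated_integral g m) ^+ 2)%:E <=
   (c * M)%:E * \int[Q]_m \int[measure_of_evaluation m]_(y in D) `|g y|%:E)%E.
Proof.
move=> mg c0 gc.
have mng : measurable_fun D (fun y => `|g y|) by exact: measurableT_comp.
have gc' y : D y -> 0 <= `|g y| <= c * f y by move=> Dy; rewrite normr_ge0 gc.
have ngc y : D y -> `| `|g y| | <= c * f y by move=> Dy; rewrite normr_id gc.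
rewrite (integral_truncated mng c0 gc') -EFinM lee_fin.
have mt := measurable_truncated_integral mg.
have mtn := measurable_truncated_integral mng.
have itn : Q.-integrable setT (EFin \o truncated_integral (fun y => `|g y|)).
  by apply: (@integrable_bounded _ _ _ _ _ (c * M)) => // m; exact: truncated_integral_bound.
have cM0 : 0 <= c * M by rewrite mulr_ge0// ltW.
rewrite -RintegralZl//; apply: le_Rintegral => //.
- apply: (@integrable_bounded _ _ _ _ _ ((c * M) ^+ 2)); first exact: measurable_funX.
  move=> m; rewrite normrX; apply: lerXn2r; rewrite ?nnegrE//.
  exact: truncated_integral_bound.
- by rewrite (_ : _ \o _ = fun y => (c * M)%:E * (truncated_integral (fun y => `|g y|) y)%:E)%E//;
    exact: integrableZl.
- move=> m _; rewrite -real_normK ?num_real// expr2.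
  apply: ler_pM => //; first exact: truncated_integral_bound.
  rewrite /truncated_integral; case: asboolP => mM; last by rewrite normr0.
  by apply: le_normr_Rintegral => //; exact: moment_lt_integrable gc mM.
Qed.

(* Reduces a linear formula for integrals to nonnegative integrands through
   [g = (g + c f) - c f]. *)
Lemma Rintegral_of_nonneg (nu : {measure set Y -> \bar R}) (I : (Y -> R) -> R) g c :
  measurable_fun D g -> 0 <= c -> (forall y, D y -> `|g y| <= c * f y) ->
  (forall h, measurable_fun D h -> (forall y, D y -> 0 <= h y <= (2 * c) * f y) ->
    (\int[nu]_(y in D) (h y)%:E = (I h)%:E)%E) ->
  I g = I (fun y => g y + c * f y) - I (fun y => c * f y) ->
  \int[nu]_(y in D) g y = I g.
Proof.
move=> mg c0 gc IE Ig.
have mcf : measurable_fun D (fun y => c * f y) by exact: measurable_funM.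
have mgc : measurable_fun D (fun y => g y + c * f y) by exact: measurable_funD.
have E1 := IE _ mgc; have E2 := IE _ mcf.
have {}E1 : (\int[nu]_(y in D) (g y + c * f y)%:E = (I (fun y => g y + c * f y)%R)%:E)%E.
  by apply: E1 => y Dy; have := gc y Dy; rewrite ler_norml => /andP[]; lra.
have {}E2 : (\int[nu]_(y in D) (c * f y)%:E = (I (fun y => c * f y)%R)%:E)%E.
  by apply: E2 => y Dy; have := mulr_ge0 c0 (f0 Dy); lra.
have integrable h : measurable_fun D h -> (forall y, D y -> 0 <= h y) ->
    (\int[nu]_(y in D) (h y)%:E = (I h)%:E)%E -> nu.-integrable D (EFin \o h).
  move=> mh h0 hE; apply/integrableP; split; first exact/measurable_EFinP.
  apply: (@le_lt_trans _ _ (I h)%:E); last exact: ltry.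
  rewrite -hE le_eqVlt; apply/orP; left; apply/eqP; apply: eq_integral => y.
  by move=> /set_mem Dy /=; rewrite ger0_norm ?h0.
have cf0 y : D y -> 0 <= c * f y by move=> Dy; rewrite mulr_ge0 ?f0.
have gc0 y : D y -> 0 <= g y + c * f y.
  by move=> Dy; have := gc y Dy; rewrite ler_norml => /andP[]; lra.
transitivity (\int[nu]_(y in D) ((g y + c * f y) - c * f y)).
  by apply: eq_Rintegral => y _; rewrite addrK.
rewrite RintegralB//; [|exact: integrable|exact: integrable].
by rewrite Ig /Rintegral E1 E2.
Qed.

End truncated_integral.

Lemma le_supnorm (R : realType) (T : Type) (D : set T) (g : T -> R) (c : R) :
  supnorm D g = c%:E -> forall x : T, D x -> `|g x| <= c.
Proof.
move=> gc x Dx; rewrite -lee_fin -gc.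
by apply: ereal_sup_ubound; exists x.
Qed.

(** * Geometry of the plane, the weight and the rescaled kernel *)

Section plane_geometry.
Context (R : realType).
Implicit Types (x y z u v w : R * R) (K : R * R -> R).

Lemma l2norm_ge0 x : 0 <= l2norm x.
Proof. exact: sqrtr_ge0. Qed.

Lemma l2norm_le x : l2norm x <= `|x.1| + `|x.2|.
Proof.
rewrite -[leRHS]ger0_norm ?addr_ge0// -sqrtr_sqr ler_wsqrtr//.
rewrite sqrrD !real_normK ?num_real// lerD2r lerDl mulrn_wge0// mulr_ge0//.
Qed.

Lemma normr1_le_l2norm x : `|x.1| <= l2norm x.
Proof. by rewrite -sqrtr_sqr ler_wsqrtr// lerDl sqr_ge0. Qed.

Lemma normr2_le_l2norm x : `|x.2| <= l2norm x.
Proof. by rewrite -sqrtr_sqr ler_wsqrtr// lerDr sqr_ge0. Qed.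

Lemma l2normZ (a : R) x : l2norm (a * x.1, a * x.2) = `|a| * l2norm x.
Proof.
by rewrite /l2norm /= !exprMn -mulrDr sqrtrM ?sqr_ge0// sqrtr_sqr.
Qed.

Lemma l2normB x y : l2norm (x - y) = l2norm (y - x).
Proof. by rewrite /l2norm /= -(sqrrN (x.1 - y.1)) -(sqrrN (x.2 - y.2)) !opprB. Qed.

Lemma lipschitz_const_ge0 K (l : R) :
  (forall x y, `|K x - K y| <= l * l2norm (x - y)) -> 0 <= l.
Proof.
move=> /(_ (1, 0) (0, 0)); rewrite /l2norm /= !subr0 expr1n expr0n addr0 sqrtr1 mulr1.
exact: le_trans.
Qed.

Lemma measurable_l2norm_sub z :
  measurable_fun setT (fun x : plane R => l2norm ((x : R * R) - z)).
Proof.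
apply: (@measurableT_comp _ _ _ _ _ _ (@Num.sqrt R)).
  by apply: continuous_measurable_fun; exact: sqrt_continuous.
by apply: measurable_funD; apply: measurable_funX; exact: measurable_funB.
Qed.

(* The sublevel sets of K are those of the infimum over rational points [q] of
   [K q + l * l2norm (x - q)]. *)
Lemma measurable_lipschitz K (l : R) :
  (forall x y, `|K x - K y| <= l * l2norm (x - y)) ->
  measurable_fun setT (K : plane R -> R).
Proof.
move=> Kl; have l0 := lipschitz_const_ge0 Kl.
move=> mT; apply: (measurability _ (RGenInftyO.measurableE R)) => //.
move=> _ [_ [a ->] <-]; rewrite setTI.
pose q2 (q : rat * rat) : R * R := (ratr q.1, ratr q.2).
rewrite [X in measurable X](_ : _ = \bigcup_(q : rat * rat)
    [set x : plane R | K (q2 q) + l * l2norm ((x : R * R) - q2 q) < a]).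
  apply: countable_bigcupT_measurable => [|q]; first exact: countableP.
  have m : measurable_fun setT (fun x : plane R => K (q2 q) + l * l2norm ((x : R * R) - q2 q)).
    apply: measurable_funD => //; apply: measurable_funM => //.
    exact: measurable_l2norm_sub.
  have := m measurableT _ (measurable_itv `]-oo, a[); rewrite setTI.
  congr measurable; apply/seteqP; split=> x /=; by rewrite in_itv.
apply/seteqP; split=> x /=.
  rewrite in_itv /= => Kxa.
  (* A rational point [q] with coordinates within [e] of those of [x] has [l2norm (x - q) <= 2 e],
     so [K q + l * l2norm (x - q)] exceeds [K x] by at most [4 l e], which is less than
     [a - K x]. *)
  pose e := (a - K x) / (4 * l + 1).
  have e0 : 0 < e by rewrite divr_gt0 ?subr_gt0//; lra.
  have close (t : R) : exists r : rat, `|t - ratr r| <= e.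
    have te : t - e < t + e by lra.
    have [r] := rat_in_itvoo te.
    rewrite in_itv /= => /andP[r1 r2]; exists r; rewrite ler_norml; lra.
  have [r1 h1] := close x.1; have [r2 h2] := close x.2.
  exists (r1, r2) => //=; set q := q2 _.
  have hq : l2norm (x - q) <= 2 * e.
    by apply: le_trans (l2norm_le _) _; rewrite /q /q2 /=; lra.
  have := Kl x q; rewrite ler_norml => /andP[k1 k2].
  have lq : l * l2norm (x - q) <= l * (2 * e) by exact: ler_wpM2l.
  have : (4 * l + 1) * e = a - K x by rewrite /e mulrC divfK// gt_eqF//; lra.
  by lra.
by move=> [q _ /= hq]; rewrite in_itv /=; have := Kl x (q2 q);
  rewrite ler_norml => /andP[]; lra.
Qed.

(** The nearest point has both coordinates [(w.1 + w.2) / 2]. The lower bound is the identity [2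
    ((w.1 - t)^2 + (w.2 - t)^2) = (w.2 - w.1)^2 + (w.1 + w.2 - 2 t)^2]. The closed form yields the
    measurability of the weight. *)
Lemma dist_diagonalE (L : R) w : Omega L w ->
  dist_diagonal L w = (w.2 - w.1) / Num.sqrt 2.
Proof.
move=> [w1 w12 w2L].
have s2 : (0 : R) < Num.sqrt 2 by rewrite sqrtr_gt0.
have s2s : Num.sqrt 2 ^+ 2 = 2 :> R by rewrite sqr_sqrtr.
have lb : lbound [set l2norm (w - x) | x in Defs.diagonal L] ((w.2 - w.1) / Num.sqrt 2).
  move=> _ [x [x12 _] <-]; rewrite -[leLHS]ger0_norm; last first.
    by rewrite divr_ge0 ?sqrtr_ge0// subr_ge0 ltW.
  rewrite -sqrtr_sqr ler_wsqrtr// exprMn exprVn s2s /= -x12.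
  have := sqr_ge0 ((w.1 - x.1) + (w.2 - x.1)).
  by rewrite -subr_ge0 => h; rewrite -subr_ge0; nra.
apply/eqP; rewrite eq_le; apply/andP; split; last first.
  apply: lb_le_inf => //; exists (l2norm (w - (0, 0))), (0, 0) => //.
  by split => //=; rewrite lexx /=; lra.
apply: ge_inf; first by exists ((w.2 - w.1) / Num.sqrt 2).
exists ((w.1 + w.2) / 2, (w.1 + w.2) / 2); first by split=> //=; lra.
rewrite /l2norm /= -[RHS]ger0_norm; last first.
  by rewrite divr_ge0 ?sqrtr_ge0// subr_ge0 ltW.
rewrite -sqrtr_sqr; congr Num.sqrt; rewrite exprMn exprVn s2s; by field.
Qed.

Lemma measurable_Omega (L : R) : measurable (Omega L : set (plane R)).
Proof.
have m1 : measurable_fun setT (fst : plane R -> R) by exact: measurable_fst.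
have m2 : measurable_fun setT (snd : plane R -> R) by exact: measurable_snd.
rewrite (_ : Omega L = (fst : plane R -> R) @^-1` `]0, +oo[ `&`
  ((fun w : plane R => w.2 - w.1) @^-1` `]0, +oo[ `&`
   (snd : plane R -> R) @^-1` `]-oo, L]%classic)); last first.
  apply/seteqP; split=> w /=; rewrite !in_itv /= !andbT subr_gt0.
    by case.
  by case=> ? [].
apply: measurableI; first by rewrite -[X in measurable X]setTI; exact: m1.
apply: measurableI; last by rewrite -[X in measurable X]setTI; exact: m2.
by rewrite -[X in measurable X]setTI; exact: (measurable_funB m2 m1).
Qed.

Lemma measurable_dist_diagonal_powR (L q : R) :
  measurable_fun (Omega L : set (plane R)) (fun w => dist_diagonal L w `^ q).
Proof.
apply: (eq_measurable_fun (fun w : plane R => ((w.2 - w.1) / Num.sqrt 2) `^ q)).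
  by move=> w /set_mem Ow; rewrite dist_diagonalE.
apply: measurable_funTS; apply: (@measurableT_comp _ _ _ _ _ _ (fun t : R => t `^ q)).
  exact: measurable_powR.
apply: measurable_funM => //; apply: measurable_funB.
  exact: measurable_snd.
exact: measurable_fst.
Qed.

Section rescaled_kernel.
Variables (K : R * R -> R) (LK Kinf h : R).
Hypothesis Klip : forall x y, `|K x - K y| <= LK * l2norm (x - y).
Hypothesis Kbound : forall x, `|K x| <= Kinf.
Hypothesis Ksupport : forall x, 1 < l2norm x -> K x = 0.
Hypothesis h0 : 0 < h.

Lemma rescale_bound x : `|rescale K h x| <= Kinf / h ^+ 2.
Proof.
rewrite /rescale normrM ger0_norm ?invr_ge0 ?exprn_ge0 ?(ltW h0)//.
by rewrite mulrC ler_wpM2r// invr_ge0 exprn_ge0// (ltW h0).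
Qed.

Lemma rescale_lipschitz x y :
  `|rescale K h x - rescale K h y| <= LK / h ^+ 3 * l2norm (x - y).
Proof.
rewrite /rescale -mulrBr normrM ger0_norm ?invr_ge0 ?exprn_ge0 ?(ltW h0)//.
apply: (@le_trans _ _ (h ^- 2 * (LK * (h^-1 * l2norm (x - y))))).
  rewrite ler_wpM2l ?invr_ge0 ?exprn_ge0 ?(ltW h0)//; apply: (le_trans (Klip _ _)).
  rewrite -[X in X * l2norm (x - y)]ger0_norm ?invr_ge0 ?(ltW h0)// -l2normZ.
  rewrite le_eqVlt; apply/orP; left; apply/eqP; congr (_ * l2norm _).
  by congr pair; rewrite /= mulrBr mulrC [_ / h]mulrC.
by rewrite le_eqVlt; apply/orP; left; apply/eqP; field; rewrite gt_eqF.
Qed.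

(** The ball of radius [h] is enlarged to a square, whose area is a product of lengths. *)
Lemma rescale_support x : ~~ (`|x.1| <= h) || ~~ (`|x.2| <= h) -> rescale K h x = 0.
Proof.
move=> H; rewrite /rescale Ksupport ?mulr0//.
have [|] := orP H; rewrite -ltNge => xh.
  apply: lt_le_trans (normr1_le_l2norm _) => /=.
  by rewrite normrM (@gtr0_norm _ h^-1) ?invr_gt0// ltr_pdivlMr// mul1r.
apply: lt_le_trans (normr2_le_l2norm _) => /=.
by rewrite normrM (@gtr0_norm _ h^-1) ?invr_gt0// ltr_pdivlMr// mul1r.
Qed.

Lemma measurable_rescale u :
  measurable_fun setT (fun w : plane R => rescale K h (u - (w : R * R))).
Proof.
apply: (@measurable_lipschitz (fun w => rescale K h (u - w)) (LK / h ^+ 3)) => x y.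
apply: le_trans (rescale_lipschitz _ _) _.
suff -> : (u - x) - (u - y) = y - x by rewrite l2normB.
by rewrite opprB addrC addrA subrK.
Qed.

End rescaled_kernel.

End plane_geometry.

(** * Signed integrals against the mean and the empirical measure *)

Section mean_and_empirical.
Context d (Y : measurableType d) (R : realType).
Variables (D : set Y) (f : Y -> R) (M : R).
Hypothesis mD : measurable D.
Hypothesis mf : measurable_fun D f.
Hypothesis f0 : forall y, D y -> 0 <= f y.
Hypothesis M0 : 0 < M.

Let restrict_ge0 (h : Y -> R) : (forall y, D y -> 0 <= h y) ->
  forall y, (0 <= ((EFin \o h) \_ D) y)%E.
Proof.
by move=> h0 y; rewrite patchE; case: ifPn => // /set_mem Dy; rewrite lee_fin h0.
Qed.

Let sum_bound (g : Y -> R) (c : R) : 0 <= c -> (forall y, D y -> `|g y| <= c * f y) ->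
  (forall y, D y -> `|g y + c * f y| <= (2 * c) * f y) /\
  (forall y, D y -> `|c * f y| <= (2 * c) * f y).
Proof.
move=> c0 gc; split=> y Dy; have cf := mulr_ge0 c0 (f0 Dy).
  apply: (le_trans (ler_normD _ _)); have := gc y Dy.
  by rewrite (ger0_norm cf); lra.
by rewrite (ger0_norm cf); lra.
Qed.

Let truncated_sum (g : Y -> R) (c : R) m : measurable_fun D g -> 0 <= c ->
  (forall y, D y -> `|g y| <= c * f y) ->
  truncated_integral D f M g m =
  truncated_integral D f M (fun y => g y + c * f y) m -
  truncated_integral D f M (fun y => c * f y) m.
Proof.
move=> mg c0 gc; have [b1 b2] := sum_bound c0 gc.
have mcf : measurable_fun D (fun y => c * f y) by exact: measurable_funM.
have mgc : measurable_fun D (fun y => g y + c * f y) by exact: measurable_funD.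
rewrite -(truncated_integralB M mD mf f0 m mgc mcf b1 b2).
by congr truncated_integral; apply/funext => y; rewrite addrK.
Qed.

Lemma Rintegral_mean_measure d' (T : measurableType d') (P : probability T R)
    (mu : R.-ker T ~> Y) (g : Y -> R) (c : R) :
  {ae kernel_law P mu, forall m, moment_lt D f M m} ->
  measurable_fun D g -> 0 <= c -> (forall y, D y -> `|g y| <= c * f y) ->
  \int[mean_measure P mu]_(y in D) g y =
  \int[kernel_law P mu]_m truncated_integral D f M g m.
Proof.
move=> aeM mg c0 gc; have [b1 b2] := sum_bound c0 gc.
have mcf : measurable_fun D (fun y => c * f y) by exact: measurable_funM.
have mgc : measurable_fun D (fun y => g y + c * f y) by exact: measurable_funD.
have c20 : 0 <= 2 * c by rewrite mulr_ge0.
apply: (Rintegral_of_nonneg mD mf f0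
  (I := fun g => \int[kernel_law P mu]_m truncated_integral D f M g m) mg c0 gc).
- move=> h mh hc; rewrite integral_mkcond integral_mean_measure//; first last.
  + by apply: restrict_ge0 => y Dy; have /andP[] := hc y Dy.
  + exact: measurable_EFin_restrict.
  rewrite -(integral_truncated mD mf f0 M0 aeM mh c20 hc).
  by apply: eq_integral => m _; rewrite -integral_mkcond.
- rewrite -RintegralB//.
  + by apply: eq_Rintegral => m _; exact: truncated_sum.
  + apply: (@integrable_bounded _ _ _ _ _ ((2 * c) * M)) => [|m].
      exact: measurable_truncated_integral.
    exact: truncated_integral_bound.
  + apply: (@integrable_bounded _ _ _ _ _ ((2 * c) * M)) => [|m].
      exact: measurable_truncated_integral.
    exact: truncated_integral_bound.
Qed.

Lemma Rintegral_empirical_measure n (m : 'I_n -> {measure set Y -> \bar R})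
    (g : Y -> R) (c : R) :
  (forall i, moment_lt D f M (m i)) ->
  measurable_fun D g -> 0 <= c -> (forall y, D y -> `|g y| <= c * f y) ->
  \int[empirical_measure m]_(y in D) g y =
  n%:R^-1 * \sum_(i < n) truncated_integral D f M g (m i).
Proof.
move=> mM mg c0 gc.
apply: (Rintegral_of_nonneg mD mf f0
  (I := fun g => n%:R^-1 * \sum_(i < n) truncated_integral D f M g (m i)) mg c0 gc).
- move=> h mh hc; rewrite integral_mkcond integral_empirical_measure; first last.
  + by apply: restrict_ge0 => y Dy; have /andP[] := hc y Dy.
  + exact: measurable_EFin_restrict.
  have hc' y : D y -> `|h y| <= (2 * c) * f y.
    by move=> Dy; have /andP[h0 ?] := hc y Dy; rewrite ger0_norm.
  rewrite EFinM -sumEFin; congr (_ * _)%E; apply: eq_bigr => i _.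
  rewrite -integral_mkcond /truncated_integral asboolT// fineK//.
  apply: integrable_fin_num => //.
  exact: (moment_lt_integrable mD mf f0 mh hc' (mM i)).
- rewrite -mulrBr -sumrB; congr (_ * _); apply: eq_bigr => i _.
  exact: truncated_sum.
Qed.

End mean_and_empirical.

(** * Integrals against the mean measure through its intensity *)

Section intensity.
Context (R : realType) (L : R) d (T : measurableType d) (P : probability T R).
Variables (mu : R.-ker T ~> plane R) (p : R * R -> R).
Hypothesis mu_p : is_intensity L P mu p.

Let mO := @measurable_Omega R L.

Lemma integral_intensity (g : plane R -> R) :
  measurable_fun (Omega L : set (plane R)) g ->
  (forall w : plane R, Omega L w -> 0 <= g w) ->
  (\int[mean_measure P mu]_(w in Omega L) (g w)%:E =
   \int[@leb2 R]_(w in Omega L) (g w * p w)%:E)%E.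
Proof.
move=> mg g0; have [mp p0 pE] := mu_p.
pose O : set (plane R) := Omega L.
pose gO : plane R -> \bar R := (EFin \o g) \_ O.
pose pO : plane R -> R := (p : plane R -> R) \_ O.
have mgO : measurable_fun setT gO by exact: measurable_EFin_restrict.
have gO0 w : (0 <= gO w)%E.
  by rewrite /gO patchE; case: ifPn => // /set_mem Ow; rewrite lee_fin g0.
have mpO : measurable_fun setT pO by apply/(measurable_restrictT _ mO).
have pO0 w : 0 <= pO w.
  by rewrite /pO patchE; case: ifPn => // /set_mem Ow; exact: p0.
have pI := @integral_positive_functional _ _ R _ _ (mean_measure P mu) id (\1_O)
  (@measurable_id _ _ setT) (@measurable_indic _ _ R setT _ mO) (fun w => ler0n _ _).
have pJ := @integral_positive_functional _ _ R _ _ (@leb2 R) id pO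
  (@measurable_id _ _ setT) mpO pO0.
have H IJ := eq_positive_functional pI pJ IJ mgO gO0.
rewrite integral_mkcond [RHS]integral_mkcond.
transitivity (\int[mean_measure P mu]_x (gO x * (\1_O x)%:E))%E.
  apply: eq_integral => w _; rewrite /gO patchE indicE -/O.
  by case: (w \in O); rewrite ?mule1 ?mul0e.
rewrite H.
  apply: eq_integral => w _; rewrite /gO /pO !patchE -/O.
  by case: (w \in O); rewrite ?mul0e// -EFinM.
move=> A mA; transitivity (mean_measure P mu (A `&` O)).
  transitivity (\int[mean_measure P mu]_w (\1_(A `&` O) w)%:E)%E; last first.
    by rewrite integral_indic ?setIT//; exact: measurableI.
  by apply: eq_integral => w _; rewrite -EFinM indicI.
transitivity (\int[@leb2 R]_(w in (A `&` O : set (plane R))) (p w)%:E)%E.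
  by apply: pE; [exact: measurableI|exact: subIsetr].
rewrite [LHS]integral_mkcond; apply: eq_integral => w _.
rewrite /pO !patchE in_setI indicE -/O.
by case: (w \in A); case: (w \in O) => //=; rewrite -EFinM ?mul1r ?mul0r ?mulr0.
Qed.

Lemma leb2_square (u : R * R) (h : R) : 0 < h ->
  leb2 R (`[u.1 - h, u.1 + h] `*` `[u.2 - h, u.2 + h])%classic = (4 * h ^+ 2)%:E.
Proof.
move=> h0.
have len (t : R) : lebesgue_measure (`[t - h, t + h]%classic : set R) = (2 * h)%:E.
  rewrite lebesgue_measure_itv /= lte_fin ifT; last by lra.
  by rewrite -EFinB; congr EFin; ring.
rewrite (_ : 4 * h ^+ 2 = (2 * h) * (2 * h)); last by ring.
rewrite EFinM -{1}(len u.1) -(len u.2).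
by apply: (@product_measure1E _ _ (measurableTypeR R) (measurableTypeR R) R
  (@lebesgue_measure R) (@lebesgue_measure R)); exact: measurable_itv.
Qed.

(** The weight is paired with the intensity, as the bound [pinf] is on their product; [B] bounds the
    kernel, and [4 h ^ 2] is the area of the square outside which it vanishes. *)
Lemma integral_weighted_kernel (f k : plane R -> R) (pinf B h : R) (u : R * R) :
  0 < h -> 0 <= B -> 0 <= pinf ->
  measurable_fun (Omega L : set (plane R)) f ->
  measurable_fun (Omega L : set (plane R)) k ->
  (forall w : plane R, Omega L w -> 0 <= f w) ->
  (forall w : plane R, Omega L w -> f w * p w <= pinf) ->
  (forall w, `|k w| <= B) ->
  (forall w : plane R, ~~ (`|u.1 - w.1| <= h) || ~~ (`|u.2 - w.2| <= h) -> k w = 0) ->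
  (\int[mean_measure P mu]_(w in Omega L) (`|f w * k w|)%:E
    <= (pinf * B * (4 * h ^+ 2))%:E)%E.
Proof.
move=> h0 B0 pinf0 mf mk f0 fp kB k0; have [mp p0 pE] := mu_p.
pose sq : set (plane R) := (`[u.1 - h, u.1 + h] `*` `[u.2 - h, u.2 + h])%classic.
have msq : measurable sq by apply: measurableX; exact: measurable_itv.
have mfk : measurable_fun (Omega L : set (plane R)) (fun w => `|f w * k w|).
  by apply: measurableT_comp => //; exact: measurable_funM.
rewrite integral_intensity//.
apply: (@le_trans _ _ (\int[@leb2 R]_(w in Omega L) ((pinf * B)%:E * (\1_sq w)%:E))%E).
  apply: ge0_le_integral => //.
  - by move=> w Ow; rewrite lee_fin mulr_ge0// p0.
  - by apply/measurable_EFinP; exact: measurable_funM.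
  - apply: measurable_funeM; apply/measurable_EFinP; apply: measurable_funTS.
    exact: measurable_indic.
  move=> w Ow; rewrite -EFinM lee_fin normrM (ger0_norm (f0 _ Ow)) mulrAC.
  have fp0 : 0 <= f w * p w by rewrite mulr_ge0 ?f0 ?p0.
  have [wsq|wsq] := boolP (w \in sq).
    by rewrite indicE wsq mulr1; apply: ler_pM => //; exact: fp.
  rewrite k0 ?normr0 ?mulr0 ?mulr_ge0 ?indicE// -negb_and.
  apply: contra wsq => /andP[w1 w2]; apply/mem_set; split => /=.
    by rewrite in_itv /= -ler_distlC.
  by rewrite in_itv /= -ler_distlC.
apply: (@le_trans _ _ (\int[@leb2 R]_w ((pinf * B)%:E * (\1_sq w)%:E))%E).
  apply: ge0_subset_integral => //.
  - by apply: measurable_funeM; apply/measurable_EFinP; exact: measurable_indic.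
  - by move=> w _; rewrite -EFinM lee_fin !mulr_ge0.
have pB0 : (0 <= (pinf * B)%:E)%E by rewrite lee_fin mulr_ge0.
rewrite ge0_integralZl//; last exact/measurable_EFinP/measurable_indic.
by rewrite integral_indic// setIT (leb2_square u h0) -EFinM.
Qed.

End intensity.

(** * Transfer from the sample to the common law *)

Section sample_law.
Context d d0 d' (T : measurableType d) (T0 : measurableType d0)
  (Y : measurableType d') (R : realType) (n : nat).
Variables (P : probability T R) (P0 : probability T0 R).
Variables (mus : 'I_n -> R.-ker T ~> Y) (mu : R.-ker T0 ~> Y).
Hypothesis same : forall i, same_law P (mus i) P0 mu.

Lemma independent_kernel_evaluations : independent_measures P mus ->
  forall A : 'I_n -> set (evaluation_space Y R), (forall i, measurable (A i)) ->
  (P [set w | forall i, A i (kernel_evaluation (mus i) w)] =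
   \prod_(i < n) kernel_law P0 mu (A i))%E.
Proof.
move=> ind A mA; transitivity (P [set w | forall i, i \in [set: 'I_n]%SET -> A i (mus i w)]).
  congr (P _); apply/seteqP; split=> w /= h i => [_|]; first exact: h.
  by apply: h; rewrite finset.inE.
rewrite ind; last by move=> i _; exact: mA.
apply: eq_big => [i|i _]; first by rewrite finset.inE.
exact: (same i (mA i)).
Qed.

(** The moment bound is assumed for the sample, on [T]; [same_law] carries it to the law of [mu],
    which lives on [T0]. *)
Lemma ae_moment_lt (D : set Y) (f : Y -> R) (M : R) (i : 'I_n) :
  measurable D -> measurable_fun D f ->
  {ae P, forall w, moment_lt D f M (mus i w)} ->
  {ae kernel_law P0 mu, forall m, moment_lt D f M m}.
Proof.
move=> mD mf [N [mN N0 Ngood]].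
have mgood := measurable_moment_lt M mD mf.
exists (~` [set m : evaluation_space Y R | moment_lt D f M m]); split => //.
  exact: measurableC.
apply/eqP; rewrite eq_le measure_ge0 andbT -N0.
have -> : kernel_law P0 mu (~` [set m | moment_lt D f M m]) =
    P (kernel_evaluation (mus i) @^-1` (~` [set m | moment_lt D f M m])).
  exact/esym/(same i (measurableC mgood)).
apply: le_measure; rewrite ?inE//.
- apply/mem_set; rewrite -[X in measurable X]setTI.
  by apply: (measurable_kernel_evaluation (mus i)) => //; exact: measurableC.
- exact/mem_set.
Qed.

End sample_law.

(** * The deviation of the persistence surface *)

Section surface_deviation.
Context (R : realType) (L M LK Kinf pinf h q : R).
Context d d0 (T : measurableType d) (T0 : measurableType d0) (n : nat).
Variables (P : probability T R) (P0 : probability T0 R).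
Variables (mus : 'I_n -> R.-ker T ~> plane R) (mu : R.-ker T0 ~> plane R).
Variables (K p : R * R -> R).
Let f := fun w : R * R => dist_diagonal L w `^ q.
Hypotheses (L0 : 0 < L) (M0 : 0 < M) (h0 : 0 < h) (n0 : (0 < n)%N).
Hypothesis Kcond : kernel_conditions K LK.
Hypothesis Ksup : supnorm setT K = Kinf%:E.
Hypothesis indep : independent_measures P mus.
Hypothesis same : forall i, same_law P (mus i) P0 mu.
Hypothesis mu_p : is_intensity L P0 mu p.
Hypothesis moment : {ae P, forall w, forall i : 'I_n,
  (\int[mus i w]_(x in Omega L) (f x)%:E < M%:E)%E}.
Hypothesis fp : supnorm (Omega L) (fun w => f w * p w) = pinf%:E.

Let Q := kernel_law P0 mu.
Let Phi i := kernel_evaluation (mus i).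
Let g (u w : R * R) : R := f w * rescale K h (u - w).
Let O : set (plane R) := Omega L.

Definition surface_functional (u : R * R) : evaluation_space (plane R) R -> R :=
  truncated_integral O f M (g u).

Let mO : measurable O. Proof. exact: measurable_Omega. Qed.

Let mf : measurable_fun O f. Proof. exact: measurable_dist_diagonal_powR. Qed.

Let f0 w : O w -> 0 <= f w. Proof. by move=> _; exact: powR_ge0. Qed.

Let LK0 : 0 <= LK. Proof. exact: lipschitz_const_ge0 (kernel_lipschitz Kcond). Qed.

Let Kb x : `|K x| <= Kinf. Proof. exact: (le_supnorm Ksup). Qed.

Let Kinf0 : 0 <= Kinf. Proof. exact: le_trans (Kb (0, 0)). Qed.

(** The added 1, here and in [LK + 1], gives strict positivity from nonnegativity alone. *)
Let B := (Kinf + 1) / h ^+ 2.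

Let B0 : 0 < B. Proof. by rewrite divr_gt0 ?exprn_gt0// ltr_wpDl. Qed.

Let rB u w : `|rescale K h (u - w)| <= B.
Proof.
apply: le_trans (rescale_bound Kb h0 _) _.
by rewrite ler_wpM2r ?invr_ge0 ?exprn_ge0 ?(ltW h0)// lerDl.
Qed.

Let mr u : measurable_fun O (fun w => rescale K h (u - w)).
Proof.
by apply: measurable_funTS; exact: (measurable_rescale (kernel_lipschitz Kcond) h0).
Qed.

Let mg u : measurable_fun O (g u).
Proof. exact: measurable_funM. Qed.

Let gB u w : O w -> `|g u w| <= B * f w.
Proof.
by move=> Ow; rewrite normrM (ger0_norm (f0 Ow)) mulrC ler_wpM2r ?f0.
Qed.

Let aeQ : {ae Q, forall m, moment_lt O f M m}.
Proof.
apply: (ae_moment_lt same (i := Ordinal n0) mO mf).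
by apply: filterS moment => w; exact.
Qed.

Lemma measurable_surface_functional u : measurable_fun setT (surface_functional u).
Proof. exact: measurable_truncated_integral. Qed.

Lemma surface_functional_bound u m : `|surface_functional u m| <= B * M.
Proof. exact: (truncated_integral_bound mO mf f0 M0 m (mg u) (ltW B0) (gB u)). Qed.

Lemma surface_functional_lipschitz u v m :
  `|surface_functional u m - surface_functional v m| <=
  (LK + 1) / h ^+ 3 * M * (`|u.1 - v.1| + `|u.2 - v.2|).
Proof.
rewrite -(truncated_integralB M mO mf f0 m (mg u) (mg v) (gB u) (gB v)).
rewrite mulrAC; apply: (truncated_integral_bound mO mf f0 M0).
- exact: measurable_funB.
- by rewrite mulr_ge0 ?addr_ge0// divr_ge0 ?exprn_ge0 ?(ltW h0)// addr_ge0.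
move=> w Ow; rewrite /g -mulrBr normrM (ger0_norm (f0 Ow)) mulrC ler_wpM2r ?f0//.
apply: le_trans (rescale_lipschitz (kernel_lipschitz Kcond) h0 _ _) _.
have h3 : 0 <= (h ^+ 3)^-1 by rewrite invr_ge0 exprn_ge0 ?(ltW h0).
apply: ler_pM.
- by rewrite mulr_ge0.
- exact: l2norm_ge0.
- by rewrite ler_wpM2r// lerDl.
rewrite (_ : (u - w) - (v - w) = u - v); first exact: l2norm_le.
by rewrite opprB addrA subrK.
Qed.

(** The product of [B M] and [pinf B 4 h ^ 2]: the area cancels one of the two factors h^-2 coming
    from [B]. *)
Lemma surface_functional_variance u :
  \int[Q]_m surface_functional u m ^+ 2 <=
  4 * M * (Kinf + 1) ^+ 2 * pinf / h ^+ 2.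
Proof.
have p0 : 0 <= pinf.
  have Oc : Omega L (L / 2, L).
    by split; rewrite /= ?divr_gt0// ltr_pdivrMr// ltr_pMr// ltr1n.
  exact: le_trans (le_supnorm fp Oc).
have fpw w : O w -> f w * p w <= pinf.
  by move=> Ow; exact: le_trans (ler_norm _) (le_supnorm fp Ow).
have kz (w : plane R) : ~~ (`|u.1 - w.1| <= h) || ~~ (`|u.2 - w.2| <= h) ->
    rescale K h (u - w) = 0.
  exact: (rescale_support (kernel_support Kcond) h0 (x := u - w)).
have := integral_weighted_kernel mu_p h0 (ltW B0) p0 mf (mr u) f0 fpw (rB u) kz.
have mng : measurable_fun O (fun w => `|g u w|) by exact: measurableT_comp.
rewrite integral_mkcond integral_mean_measure; first last.
- by move=> w; rewrite patchE; case: ifP => // _; rewrite lee_fin.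
- exact: (measurable_EFin_restrict mO mng).
move=> V; rewrite -lee_fin.
apply: (le_trans (truncated_integral_sqr mO mf f0 M0 aeQ (mg u) (ltW B0) (gB u))).
apply: (@le_trans _ _ ((B * M)%:E * (pinf * B * (4 * h ^+ 2))%:E)%E).
  apply: lee_wpmul2l; first by rewrite lee_fin mulr_ge0// ltW.
  apply: le_trans V; rewrite le_eqVlt; apply/orP; left; apply/eqP.
  by apply: eq_integral => m _; rewrite integral_mkcond.
rewrite -EFinM lee_fin le_eqVlt; apply/orP; left; apply/eqP.
by rewrite /B; field; rewrite gt_eqF.
Qed.

Lemma surface_deviationE (u : R * R) w :
  (forall i, moment_lt O f M (mus i w)) ->
  persistence_surface L f K h (empirical_measure (fun i => mus i w)) u -
  persistence_surface L f K h (mean_measure P0 mu) u =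
  deviation Q Phi (surface_functional u) w.
Proof.
move=> good.
rewrite /persistence_surface /deviation /surface_functional.
rewrite (Rintegral_empirical_measure mO mf f0 good (mg u) (ltW B0) (gB u)).
by rewrite (Rintegral_mean_measure mO mf f0 M0 aeQ (mg u) (ltW B0) (gB u)).
Qed.

Let mPhi i : measurable_fun setT (Phi i).
Proof. exact: measurable_kernel_evaluation. Qed.

Let iPhi := independent_kernel_evaluations same indep.

Lemma surface_hoeffding (x : R) u : 0 <= x ->
  likely P (2 * expR (- x)) [set w |
    `|deviation Q Phi (surface_functional u) w| <= B * M * Num.sqrt (32 * x / n%:R)].
Proof.
move=> x0; apply: (hoeffding_deviation mPhi iPhi n0) => //.
- exact: measurable_surface_functional.
- by rewrite mulr_gt0.
- exact: surface_functional_bound.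
Qed.

Lemma surface_bernstein (lam x : R) u : 0 < lam -> lam * (2 * (B * M)) <= 2^-1 ->
  likely P (2 * expR (- x)) [set w |
    `|deviation Q Phi (surface_functional u) w| <=
    x / (n%:R * lam) + 2 * lam * (4 * M * (Kinf + 1) ^+ 2 * pinf / h ^+ 2)].
Proof.
move=> lam0 lamB; apply: (bernstein_deviation mPhi iPhi n0) lamB => //.
- exact: measurable_surface_functional.
- exact: surface_functional_bound.
- exact: surface_functional_variance.
Qed.

Lemma surface_chaining (N0 : nat) (x t0 : R) : (0 < N0)%N -> 0 < x ->
  expR (- x) <= 8^-1 ->
  (forall u, likely P (2 * expR (- x))
    [set w | `|deviation Q Phi (surface_functional u) w| <= t0]) ->
  likely P (18 * N0.+1%:R ^+ 2 * expR (- x))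
    [set w | (supnorm (Omega L)
      (persistence_surface L f K h (empirical_measure (fun i => mus i w))
       \- persistence_surface L f K h (mean_measure P0 mu))%R
     <= (t0 + 5 * ((LK + 1) / h ^+ 3 * M * (L / N0%:R)) * Num.sqrt (32 * x / n%:R))%:E)%E].
Proof.
move=> N00 x0 x8 level0.
have lip0 : 0 < (LK + 1) / h ^+ 3 * M.
  by rewrite mulr_gt0// divr_gt0 ?exprn_gt0// ltr_wpDl.
have H := chaining mPhi iPhi n0 L0 lip0 measurable_surface_functional
  surface_functional_bound surface_functional_lipschitz N00 x8 x0 level0.
(* Only on this event are the truncated integrals of the sample known to be the true ones. *)
have good : likely P 0 [set w | forall i : 'I_n, moment_lt O f M (mus i w)].
  move: moment => [N [mN PN Nsub]]; exists (~` N); last by rewrite setCK PN.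
  split; first exact: measurableC.
  by move=> w nN; apply: contrapT => bad; apply: nN; exact: Nsub.
have := likelyI H good; rewrite addr0; apply: likelyS => // w [/= Hw gw].
apply: ge_ereal_sup => _ [u Ou <-]; rewrite lee_fin /=.
rewrite surface_deviationE//; apply: Hw; have [u1 u12 u2] := Ou; lra.
Qed.

(** * Choice of the parameters in the two bandwidth regimes *)

Variables (kappa delta : R).
Hypothesis kappa01 : 0 < kappa < 1.
Hypothesis delta01 : 0 < delta < 1.
Hypothesis delta_h : delta * h ^+ 2 <= kappa.

Let l0 := ln (kappa^-1).
(** In [expR (- (A l))] the summand 2 yields [(delta h ^ 2) ^ 2]. As [l >= l0], the rest contributes
    a factor at most [(162 + 72 / l0)^-1], hence at most both [1 / 162] and [l0 / 72]. Here 162 = 18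
    * 3^2 and 72 = 18 * 2^2 come from [chaining] with [N0 + 1 <= 3 h^-2] and with [N0 = 1]. *)
Let A := 2 + (162 + 72 / l0) / l0.
(** With this value [lam = a h ^ 2] meets Bernstein's constraint [lam * (2 B M) <= 1 / 2] with
    equality. *)
Let a := (4 * (Kinf + 1) * M)^-1.

(** The first two summands cover Bernstein's bound on the grid for [h < 1], the third Hoeffding's
    for [h >= 1], and the last the chaining in both regimes. *)
Definition deviation_constant : R :=
  A / a + 2 * a * (4 * M * (Kinf + 1) ^+ 2 * pinf) +
  (Kinf + 1) * M * Num.sqrt (32 * A) +
  5 * (LK + 1) * M * L * Num.sqrt (32 * A).

Let l := ln ((delta * h ^+ 2)^-1).
Let tau := (n%:R * h ^+ 2)^-1 * l.
Let s := Num.sqrt ((n%:R * h ^+ 2)^-1) * Num.sqrt l.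

Let h2 : 0 < h ^+ 2. Proof. by rewrite exprn_gt0. Qed.

Let dh0 : 0 < delta * h ^+ 2.
Proof. by rewrite mulr_gt0//; case/andP: delta01. Qed.

Let l0_gt0 : 0 < l0.
Proof.
have /andP[k0 k1] := kappa01.
by rewrite /l0 lnV ?posrE// oppr_gt0 ln_lt0// k0.
Qed.

Let le_l0_l : l0 <= l.
Proof.
have /andP[k0 k1] := kappa01.
rewrite /l0 /l !lnV ?posrE// lerN2 ler_ln ?posrE//.
Qed.

Let l_gt0 : 0 < l. Proof. exact: lt_le_trans le_l0_l. Qed.

Let expl : expR (- l) = delta * h ^+ 2.
Proof. by rewrite /l lnV ?posrE// opprK lnK ?posrE. Qed.

Let nR : (0 : R) < n%:R. Proof. by rewrite ltr0n. Qed.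

Let tau0 : 0 < tau. Proof. by rewrite mulr_gt0// invr_gt0 mulr_gt0. Qed.

Let s_sqrt : s = Num.sqrt tau.
Proof. by rewrite /s /tau sqrtrM// invr_ge0 mulr_ge0// ltW. Qed.

Let s0 : 0 < s. Proof. by rewrite s_sqrt sqrtr_gt0. Qed.

Let s2 : s ^+ 2 = tau. Proof. by rewrite s_sqrt sqr_sqrtr// ltW. Qed.

Let c162 : 0 < 162 + 72 / l0.
Proof. by rewrite addr_gt0 ?divr_gt0 ?ltr0n. Qed.

Let k0 : 0 < (162 + 72 / l0) / l0.
Proof. exact: divr_gt0. Qed.

Let A0 : 0 < A. Proof. by rewrite addr_gt0 ?ltr0n. Qed.

Let expk : expR (- ((162 + 72 / l0) / l0 * l0)) <= (162 + 72 / l0)^-1.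
Proof.
rewrite divfK ?gt_eqF// expRN lef_pV2 ?posrE ?expR_gt0//.
by apply: le_trans (expR_ge1Dx _); rewrite lerDr.
Qed.

Let le162 : (162 + 72 / l0)^-1 <= 162^-1.
Proof.
by rewrite lef_pV2 ?posrE ?ltr0n// lerDl; apply: divr_ge0; rewrite ?ler0n ?(ltW l0_gt0).
Qed.

Let le72 : (162 + 72 / l0)^-1 <= l0 / 72.
Proof.
by rewrite -[l0 / 72]invrK lef_pV2 ?posrE ?invr_gt0 ?divr_gt0 ?ltr0n// invf_div lerDr ler0n.
Qed.

Let dev_bound (C : R) : set T := [set w | (supnorm (Omega L)
      (persistence_surface L f K h (empirical_measure (fun i => mus i w))
       \- persistence_surface L f K h (mean_measure P0 mu))%R <= C%:E)%E].

Let pinf0 : 0 <= pinf.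
Proof.
have Oc : Omega L (L / 2, L).
  by split; rewrite /= ?divr_gt0// ltr_pdivrMr// ltr_pMr// ltr1n.
exact: le_trans (le_supnorm fp Oc).
Qed.

Let Kinf1 : 0 < Kinf + 1. Proof. by rewrite ltr_wpDl. Qed.

Let a0 : 0 < a. Proof. by rewrite invr_gt0 !mulr_gt0. Qed.

Let S0 : 0 <= Num.sqrt (32 * A). Proof. exact: sqrtr_ge0. Qed.

Let V0 : 0 <= 4 * M * (Kinf + 1) ^+ 2 * pinf.
Proof. by rewrite !mulr_ge0// ?exprn_ge0// ltW. Qed.

Let sqrt_sample (c y : R) : 0 <= c -> y = 32 * A * (c ^+ 2 * tau) ->
  Num.sqrt y = Num.sqrt (32 * A) * (c * s).
Proof.
move=> c0 ->; rewrite sqrtrM; last by rewrite mulr_ge0// ltW.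
by rewrite (@sqrtrM _ (c ^+ 2)) ?sqr_ge0// sqrtr_sqr ger0_norm// -s_sqrt.
Qed.

Let tauE : tau * (n%:R * h ^+ 2) = l.
Proof. by rewrite /tau mulrC mulrA mulfV ?mul1r// gt_eqF// mulr_gt0. Qed.

Let exp_split z : 1 <= z ->
  expR (- (A * l * z)) <= expR (- (2 * l * z)) * (162 + 72 / l0)^-1.
Proof.
move=> z1; have -> : - (A * l * z) = - (2 * l * z) + - ((162 + 72 / l0) / l0 * (l * z)).
  by rewrite /A; ring.
rewrite expRD ler_pM2l ?expR_gt0//; apply: le_trans expk.
rewrite ler_expR lerN2 ler_pM2l//; apply: (le_trans le_l0_l).
by rewrite ler_peMr// ltW.
Qed.

(* Here [l] can be much smaller than [ln delta^-1], whence the [h ^+ 2] in [x]. *)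
Lemma large_bandwidth : 1 <= h ->
  likely P delta (dev_bound (deviation_constant * Num.max tau s)).
Proof.
move=> h1; have h21 : 1 <= h ^+ 2 by rewrite exprn_ege1.
pose x := A * l * h ^+ 2.
have x0 : 0 < x by rewrite !mulr_gt0.
(* One [l] is split off to produce [delta h ^ 2]. The exponent left is at least [l h ^ 2], so its
   exponential is at most [1 / (l h ^ 2)], which cancels [h ^ 2]. *)
have e1 : expR (- (2 * l * h ^+ 2)) <= delta / l.
  have -> : - (2 * l * h ^+ 2) = - (2 * l * h ^+ 2 - l) - l by ring.
  rewrite expRD expl.
  have e2 : expR (- (2 * l * h ^+ 2 - l)) <= (l * h ^+ 2)^-1.
    rewrite expRN lef_pV2 ?posrE ?expR_gt0 ?mulr_gt0//.
    have lh : l <= l * h ^+ 2 by rewrite ler_peMr// ltW.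
    by apply: le_trans (expR_ge1Dx _); move: lh; lra.
  apply: (@le_trans _ _ ((l * h ^+ 2)^-1 * (delta * h ^+ 2))).
    by rewrite ler_wpM2r// ltW.
  by rewrite le_eqVlt; apply/orP; left; apply/eqP; field; rewrite !gt_eqF.
have e3 : expR (- x) <= delta / l * (162 + 72 / l0)^-1.
  apply: (le_trans (exp_split h21)); rewrite ler_wpM2r//.
  by rewrite invr_ge0 ltW.
have [d0' d1] := andP delta01.
have e72 : 72 * expR (- x) <= delta.
  have : delta / l * (162 + 72 / l0)^-1 <= delta / l * (l0 / 72).
    by rewrite ler_pM2l ?divr_gt0.
  have : delta / l * (l0 / 72) <= delta / l * (l / 72).
    by rewrite ler_pM2l ?divr_gt0// ler_pM2r.
  have : delta / l * (l / 72) = delta / 72 by field; rewrite gt_eqF.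
  by move: e3; lra.
have x8 : expR (- x) <= 8^-1 by move: e72; lra.
have sx : Num.sqrt (32 * x / n%:R) = Num.sqrt (32 * A) * (h ^+ 2 * s).
  apply: sqrt_sample; first exact: ltW.
  by rewrite /x -tauE; field; rewrite gt_eqF.
(* A single cell is enough: the Lipschitz factor h^-3 against the deviation h^2 [s] leaves
   [s / h <= s]. *)
have := surface_chaining (N0 := 1) isT x0 x8
  (fun u => surface_hoeffding u (ltW x0)).
apply: likelyS; first by rewrite (_ : 18 * 2 ^+ 2 = 72)//; ring.
move=> w; rewrite /dev_bound /=; move/le_trans; apply; rewrite lee_fin sx divr1.
set S := Num.sqrt (32 * A); have S0' : 0 <= S by exact: S0.
have -> : B * M * (S * (h ^+ 2 * s)) = (Kinf + 1) * M * S * s.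
  by rewrite /B; field; rewrite gt_eqF.
have -> : 5 * ((LK + 1) / h ^+ 3 * M * L) * (S * (h ^+ 2 * s)) =
    5 * (LK + 1) * M * L * S * s / h.
  by field; rewrite gt_eqF.
have c0 : 0 <= 5 * (LK + 1) * M * L * S.
  by rewrite !mulr_ge0 ?addr_ge0 ?(ltW M0) ?(ltW L0).
have c1 : 0 <= (Kinf + 1) * M * S by rewrite !mulr_ge0 ?(ltW M0) ?(ltW Kinf1).
have c2 : 0 <= A / a + 2 * a * (4 * M * (Kinf + 1) ^+ 2 * pinf).
  by rewrite addr_ge0 ?divr_ge0 ?(ltW A0) ?(ltW a0)// mulr_ge0// mulr_ge0// ltW.
have cC : 0 <= deviation_constant by exact: (addr_ge0 (addr_ge0 c2 c1) c0).
apply: (@le_trans _ _ (deviation_constant * s)); last first.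
  by rewrite ler_wpM2l// le_max lexx orbT.
rewrite /deviation_constant -/S 2!(mulrDl _ _ s); apply: lerD.
  by rewrite lerDr mulr_ge0// ltW.
rewrite -[leRHS]mulr1; apply: ler_wpM2l; last by rewrite invf_le1.
exact: (mulr_ge0 c0 (ltW s0)).
Qed.

(** Probability budget: the grid costs [18 (N0 + 1) ^ 2 <= 162 h^-4], and [expR (- x)] is at most
    [delta ^ 2 h ^ 4 / 162]; the product is [delta ^ 2 <= delta]. *)
Lemma small_bandwidth : h < 1 ->
  likely P delta (dev_bound (deviation_constant * Num.max tau s)).
Proof.
move=> h1; have [d0' d1] := andP delta01.
have h2V : 1 <= (h ^+ 2)^-1 by rewrite invf_ge1// exprn_ile1// ltW.
pose x := A * l.
have x0 : 0 < x by rewrite mulr_gt0.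
have e1 : expR (- x) <= (delta * h ^+ 2) ^+ 2 / 162.
  have := exp_split (lexx 1); rewrite !mulr1 => /le_trans; apply.
  have -> : - (2 * l) = - l + - l by ring.
  rewrite expRD expl -expr2 ler_wpM2l//; exact: sqr_ge0.
pose N0 := (Num.truncn ((h ^+ 2)^-1)).+1.
have N0R : (0 : R) < N0%:R by rewrite ltr0n.
have N0h : (h ^+ 2)^-1 <= N0%:R by rewrite ltW// truncnS_gt.
have hN0 : N0.+1%:R <= 3 * (h ^+ 2)^-1.
  have : (Num.truncn ((h ^+ 2)^-1))%:R <= (h ^+ 2)^-1.
    by rewrite truncn_le// invr_ge0 ltW.
  by rewrite /N0 -!natr1; lra.
have prob : 18 * N0.+1%:R ^+ 2 * expR (- x) <= delta.
  apply: (@le_trans _ _ (18 * (3 * (h ^+ 2)^-1) ^+ 2 * ((delta * h ^+ 2) ^+ 2 / 162))).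
    apply: ler_pM.
    - by rewrite mulr_ge0// exprn_ge0.
    - exact: expR_ge0.
    - rewrite ler_wpM2l//; apply: lerXn2r => //; rewrite nnegrE ?ler0n//.
      exact: le_trans (ler0n _ _) hN0.
    - exact: e1.
  rewrite (_ : 18 * _ * _ = delta ^+ 2); last by field; rewrite gt_eqF.
  by rewrite expr2 ler_piMr// ltW.
have x8 : expR (- x) <= 8^-1.
  apply: (le_trans e1); have /andP[k1 k2] := kappa01.
  have : (delta * h ^+ 2) ^+ 2 <= 1.
    by rewrite exprn_ile1 ?(ltW dh0)// (le_trans delta_h)// ltW.
  by lra.
have sx : Num.sqrt (32 * x / n%:R) = Num.sqrt (32 * A) * (h * s).
  apply: sqrt_sample; first exact: ltW.
  by rewrite /x -tauE; field; rewrite gt_eqF.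
(* With [lam = a h ^ 2 r] Bernstein's threshold is [(A / a) (tau / r)] plus a multiple of [r]. The
   balance is at [r = s], because [tau = s ^ 2]; the constraint on [lam] caps [r] at 1, and there
   the term [tau] of the maximum takes over. *)
pose r := Num.min 1 s.
have r0 : 0 < r by rewrite lt_min ltr01 s0.
have r1 : r <= 1 by rewrite ge_min lexx.
have rs : r <= s by rewrite ge_min lexx orbT.
pose lam := a * h ^+ 2 * r.
have lam0 : 0 < lam by rewrite !mulr_gt0.
have lamB : lam * (2 * (B * M)) <= 2^-1.
  rewrite (_ : lam * _ = r / 2); first by lra.
  by rewrite /lam /a /B; field; rewrite !gt_eqF.
have := surface_chaining (N0 := N0) isT x0 x8
  (fun u => surface_bernstein x u lam0 lamB).
apply: likelyS => // w; rewrite /dev_bound /=; move/le_trans; apply.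
rewrite lee_fin sx.
set S := Num.sqrt (32 * A); have S0' : 0 <= S by exact: S0.
set V := 4 * M * (Kinf + 1) ^+ 2 * pinf; have V0' : 0 <= V by exact: V0.
set D := Num.max tau s.
have sD : s <= D by rewrite le_max lexx orbT.
have D0 : 0 < D by exact: lt_le_trans sD.
have tauD : tau / r <= D.
  rewrite ler_pdivrMr// /r; case: (leP 1 s) => s1.
    by rewrite mulr1 le_max lexx.
  by rewrite -s2 expr2 ler_wpM2r ?(ltW s0).
have T1 : x / (n%:R * lam) <= A / a * D.
  rewrite (_ : x / _ = A / a * (tau / r)); first by rewrite ler_pM2l ?divr_gt0.
  by rewrite /x -tauE /lam; field; rewrite !gt_eqF.
have T2 : 2 * lam * (V / h ^+ 2) <= 2 * a * V * D.
  rewrite (_ : _ * _ = 2 * a * V * r); last by rewrite /lam; field; rewrite gt_eqF.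
  have aV0 : 0 <= 2 * a * V by rewrite mulr_ge0// mulr_ge0// ltW.
  exact: (ler_wpM2l aV0 (le_trans rs sD)).
(* Lipschitz factor h^-3, mesh at most [L h ^ 2] and deviation of order [h s]: the powers of [h]
   cancel. *)
have T3 : 5 * ((LK + 1) / h ^+ 3 * M * (L / N0%:R)) * (S * (h * s)) <=
    5 * (LK + 1) * M * L * S * D.
  have c0 : 0 <= 5 * (LK + 1) * M * L * S.
    by rewrite !mulr_ge0 ?addr_ge0 ?(ltW M0) ?(ltW L0).
  rewrite (_ : _ * (S * _) = 5 * (LK + 1) * M * L * S * (s * ((h ^+ 2)^-1 / N0%:R))); last first.
    by field; rewrite !gt_eqF.
  rewrite ler_wpM2l//; apply: le_trans sD.
  by rewrite ler_piMr ?(ltW s0)// ler_pdivrMr// mul1r.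
have T4 : 0 <= (Kinf + 1) * M * S * D.
  by rewrite !mulr_ge0 ?(ltW M0) ?(ltW Kinf1) ?(ltW D0).
rewrite /deviation_constant -/S -/V 3!(mulrDl _ _ D).
rewrite -[leLHS]addr0 addrAC; apply: lerD => //.
by apply: lerD => //; exact: lerD.
Qed.

End surface_deviation.

Theorem theoremC10 (R : realType) (L M LK Kinf pinf kappa : R) :
  0 < L -> 0 < M -> 0 < kappa < 1 ->
  exists C : R,
    forall (K : R * R -> R) (h q : R) (n : nat)
      (d d0 : measure_display) (T : measurableType d) (T0 : measurableType d0)
      (P : probability T R) (P0 : probability T0 R)
      (mus : 'I_n -> R.-ker T ~> plane R) (mu : R.-ker T0 ~> plane R)
      (p : R * R -> R),
    let f := fun w => dist_diagonal L w `^ q in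
    kernel_conditions K LK ->
    supnorm setT K = Kinf%:E ->
    0 < h -> 0 < q -> (0 < n)%N ->
    (forall i w, is_persistence_measure L (mus i w)) ->
    (forall w, is_persistence_measure L (mu w)) ->
    independent_measures P mus ->
    (forall i, same_law P (mus i) P0 mu) ->
    is_intensity L P0 mu p ->
    {ae P, forall w, forall i : 'I_n,
      (\int[mus i w]_(x in Omega L) (f x)%:E < M%:E)%E} ->
    supnorm (Omega L) (fun w => f w * p w) = pinf%:E ->
    forall delta : R, 0 < delta < 1 ->
    (* keeps the logarithm below bounded away from 0 *)
    delta * h ^+ 2 <= kappa ->
    let bound := C * Num.max
        ((n%:R * h ^+ 2)^-1 * ln ((delta * h ^+ 2)^-1))
        (Num.sqrt ((n%:R * h ^+ 2)^-1) * Num.sqrt (ln ((delta * h ^+ 2)^-1))) in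
    with_probability_at_least P (1 - delta)
      [set w | (supnorm (Omega L)
          (persistence_surface L f K h (empirical_measure (fun i => mus i w))
           \- persistence_surface L f K h (mean_measure P0 mu))%R
        <= bound%:E)%E].
Proof.
move=> L0 M0 kappa01; exists (deviation_constant L M LK Kinf pinf kappa).
move=> K h q n d d0 T T0 P P0 mus mu p f Kc Ks h0 q0 n0 _ _ ind same mu_p mom fp.
move=> delta delta01 dh bound.
have [E [mE EA] Ed] : likely P delta
    [set w | (supnorm (Omega L)
      (persistence_surface L f K h (empirical_measure (fun i => mus i w))
       \- persistence_surface L f K h (mean_measure P0 mu))%R <= bound%:E)%E].
  have [h1|h1] := leP 1 h.
    exact: (large_bandwidth L0 M0 h0 n0 Kc Ks ind same mom fp kappa01 delta01 dh h1).
  exact: (small_bandwidth L0 M0 h0 n0 Kc Ks ind same mu_p mom fp kappa01 delta01 dh h1).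
exists E => //; rewrite -[E]setCK probability_setC; last exact: measurableC.
by rewrite EFinB leeB.
Qed.
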